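(* Let $\mathcal E$ be an ES and $>$ a $\mathcal B$-compatible reduction order. For every fair and non-failing run $(\mathcal E_0,\mathcal R_0)\vdash_{\mathcal I_A}(\mathcal E_1,\mathcal R_1)\vdash_{\mathcal I_A}\cdots\vdash_{\mathcal I_A}(\mathcal E_n,\mathcal R_n)$ for $\mathcal E$, the TRS $\mathcal R_n$ is a $\mathcal B$-complete representation of $\mathcal E$: $\leftrightarrow^*_{\mathcal E\cup\mathcal B}=\leftrightarrow^*_{\mathcal R_n\cup\mathcal B}$, $\mathcal R_n$ is terminating modulo $\mathcal B$, and $\mathcal R_n$ is Church–Rosser modulo $\mathcal B$.
   Context: Terms over a signature $\mathcal F$ and variables. A rule $\ell\to r$: $\ell$ not a variable, $\mathrm{Var}(r)\subseteq\mathrm{Var}(\ell)$. For a set $\mathcal E$ of pairs of terms (equations and rules read as oriented pairs), $s\to_{\mathcal E}t$ iff $s|_p=\ell\sigma$, $t=s[r\sigma]_p$ for some $(\ell,r)\in\mathcal E$, position $p$, substitution $\sigma$; $\leftarrow$ is the inverse, $\leftrightarrow$ the symmetric closure. $\mathcal B$ is a fixed ES with $\mathrm{Var}(\ell)=\mathrm{Var}(r)$ for all $\ell\approx r\in\mathcal B$; $\sim_{\mathcal B}=\leftrightarrow^*_{\mathcal B}$, $\mathcal B^\pm=\mathcal B\cup\{t\approx s\mid s\approx t\in\mathcal B\}$; $\to_{\mathcal R/\mathcal B}=\sim_{\mathcal B}\cdot\to_{\mathcal R}\cdot\sim_{\mathcal B}$; $s\downarrow^\sim_{\mathcal R}t$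 iff $s\to^*_{\mathcal R}\cdot\sim_{\mathcal B}\cdot\leftarrow^*_{\mathcal R}t$. $\mathcal R$ is terminating modulo $\mathcal B$ if $\to_{\mathcal R/\mathcal B}$ admits no infinite sequence, Church–Rosser modulo $\mathcal B$ if $\leftrightarrow^*_{\mathcal R\cup\mathcal B}\subseteq\downarrow^\sim_{\mathcal R}$. A $\mathcal B$-compatible reduction order is a well-founded order on terms closed under contexts and substitutions with $\sim_{\mathcal B}\cdot>\cdot\sim_{\mathcal B}\subseteq>$. Inference system $\mathcal I_A$ (parameterized by $>$) on pairs $(\mathcal E,\mathcal R)$ ($\uplus$ disjoint union, $s\approx^\pm t$ means $s\approx t$ or $t\approx s$): Deduce (peak): $(\mathcal E,\mathcal R)\vdash(\mathcal E\cup\{s\approx t\},\mathcal R)$ if $s\leftarrow_{\mathcal R}\cdot\to_{\mathcal R}t$. Deduce (cliff): $(\mathcal E,\mathcal R)\vdash(\mathcal E,\mathcal R\cup\{t\to s\})$ if $s\leftarrow_{\mathcal R}\cdot\leftrightarrow_{\mathcal B}t$. Orient: $(\mathcal E\uplus\{s\approx^\pm t\},\mathcal R)\vdash(\mathcal E,\mathcal R\cup\{s\to t\})$ if $s>t$. Delete: $(\mathcal E\uplus\{s\approx t\},\mathcal R)\vdash(\mathcal E,\mathcal R)$ if $s\sim_{\mathcal B}t$. Simplify: $(\mathcal E\uplus\{s\approx^\pm t\},\mathcal R)\vdash(\mathcal E\cup\{u\approx t\},\mathcal R)$ if $s\to_{\mathcal R/\mathcal B}u$. Collapse: $(\mathcal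 E,\mathcal R\uplus\{s\to t\})\vdash(\mathcal E\cup\{u\approx t\},\mathcal R)$ if $s\to_{\mathcal R}u$. Compose: $(\mathcal E,\mathcal R\uplus\{s\to t\})\vdash(\mathcal E,\mathcal R\cup\{s\to u\})$ if $t\to_{\mathcal R/\mathcal B}u$. A run for $\mathcal E$ is a finite sequence of $\mathcal I_A$-steps from $(\mathcal E_0,\mathcal R_0)=(\mathcal E,\varnothing)$ to $(\mathcal E_n,\mathcal R_n)$; it fails if $\mathcal E_n\neq\varnothing$. It is fair if $\mathcal R_n$ is left-linear and $\mathrm{PCP}(\mathcal R_n)\subseteq\ \downarrow^\sim_{\mathcal R_n}\cup\bigcup_{i=0}^n\leftrightarrow_{\mathcal E_i\cup\mathcal R_i}$ and $\mathrm{PCP}^\pm(\mathcal R_n,\mathcal B^\pm)\subseteq\ \downarrow^\sim_{\mathcal R_n}\cup\bigcup_{i=0}^n\leftrightarrow_{\mathcal R_i}$. Critical pairs: for sets of oriented pairs $\mathcal R_1,\mathcal R_2$ (equations of $\mathcal B^\pm$ read as oriented pairs), an overlap is $\langle\ell_1\to r_1,p,\ell_2\to r_2\rangle$ with $\ell_i\to r_i$ variants of elements of $\mathcal R_i$ without common variables, $p$ a non-variable position of $\ell_2$, $\ell_1$ and $\ell_2|_p$ unifiable, and the two rules not variants if $p=\epsilon$; with an mgu $\sigma$ it yields the critical peak $\ell_2\sigma[r_1\sigma]_p\leftarrow^p\ell_2\sigma\to^\epsilon r_2\sigma$ and critical pair $\ell_2\sigma[r_1\sigma]_p\approx r_2\sigma$.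 The peak is prime if all proper subterms of $\ell_2\sigma|_p$ are normal forms w.r.t. the TRS $\mathcal R$ under consideration (also for overlaps involving $\mathcal B^\pm$). $\mathrm{PCP}(\mathcal R)$: prime critical pairs from overlaps of $\mathcal R$ with itself; $\mathrm{PCP}^\pm(\mathcal R,\mathcal B^\pm)$: prime critical pairs from overlaps between $\mathcal R$ and $\mathcal B^\pm$ in either order. *)

(* Defs.v *)
From Stdlib Require Import List Relations.
Import ListNotations.

Set Implicit Arguments.

Inductive term (F : Type) : Type :=
| Var : nat -> term F
| Fun : F -> list (term F) -> term F.
Arguments Var {F} _.
Arguments Fun {F} _ _.

Section Terms.
Variable F : Type.
Variable ar : F -> nat.

Fixpoint wf (t : term F) : Prop :=
  match t with
  | Var _ => True
  | Fun f ts =>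
      length ts = ar f /\
      (fix wfl (l : list (term F)) : Prop :=
         match l with nil => True | u :: l' => wf u /\ wfl l' end) ts
  end.

Fixpoint vars (t : term F) : list nat :=
  match t with
  | Var x => [x]
  | Fun _ ts => flat_map vars ts
  end.

Fixpoint subst (s : nat -> term F) (t : term F) : term F :=
  match t with
  | Var x => s x
  | Fun f ts => Fun f (map (subst s) ts)
  end.

(* subterm at a position (positions are lists of argument indices, from 0) *)
Fixpoint subterm_at (t : term F) (p : list nat) : option (term F) :=
  match p with
  | nil => Some t
  | i :: q =>
      match t with
      | Var _ => None
      | Fun _ ts =>
          match nth_error ts i with
          | Some u => subterm_at u q
          | None => None
          end
      end
  end.

(* t[u]_p (identity if p is not a position of t) *)
Fixpoint replace_at (t : term F) (p : list nat) (u : term F) : term F :=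
  match p with
  | nil => u
  | i :: q =>
      match t with
      | Var _ => t
      | Fun f ts =>
          match nth_error ts i with
          | Some ti => Fun f (firstn i ts ++ replace_at ti q u :: skipn (S i) ts)
          | None => t
          end
      end
  end.

Definition pairs := term F -> term F -> Prop.

Definition empty_pairs : pairs := fun _ _ => False.
Definition punion (X Y : pairs) : pairs := fun a b => X a b \/ Y a b.
Definition add (X : pairs) (s t : term F) : pairs :=
  fun a b => X a b \/ (a = s /\ b = t).
Definition remove (X : pairs) (s t : term F) : pairs :=
  fun a b => X a b /\ ~ (a = s /\ b = t).
Definition seteq (X Y : pairs) : Prop := forall a b, X a b <-> Y a b.
Definition sym_pairs (X : pairs) : pairs := fun a b => X a b \/ X b a.

Definition rstep (X : pairs) (s t : term F) : Prop :=
  wf s /\ wf t /\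
  exists l r p sg, X l r /\ subterm_at s p = Some (subst sg l) /\
                   t = replace_at s p (subst sg r).

Definition sym_step (X : pairs) (s t : term F) : Prop :=
  rstep X s t \/ rstep X t s.

Definition conv (X : pairs) : relation (term F) := clos_refl_trans _ (sym_step X).

Section ModB.
Variable B : pairs.

Definition simB : relation (term F) := conv B.

Definition rstep_mod (R : pairs) (s t : term F) : Prop :=
  exists s' t', simB s s' /\ rstep R s' t' /\ simB t' t.

Definition joinable_mod (R : pairs) (s t : term F) : Prop :=
  exists u v, clos_refl_trans _ (rstep R) s u /\ simB u v /\
              clos_refl_trans _ (rstep R) t v.

Definition terminating_mod (R : pairs) : Prop :=
  ~ exists f : nat -> term F, forall i, rstep_mod R (f i) (f (S i)).

Definition church_rosser_mod (R : pairs) : Prop :=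
  forall s t, conv (punion R B) s t -> joinable_mod R s t.

Definition B_compatible_reduction_order (gt : term F -> term F -> Prop) : Prop :=
  (forall s, wf s -> ~ gt s s) /\
  (forall s t u, wf s -> wf t -> wf u -> gt s t -> gt t u -> gt s u) /\
  (~ exists f : nat -> term F, forall i, wf (f i) /\ gt (f i) (f (S i))) /\
  (forall C p s t, wf C -> subterm_at C p <> None -> wf s -> wf t -> gt s t ->
       gt (replace_at C p s) (replace_at C p t)) /\
  (forall sg s t, (forall x, wf (sg x)) -> wf s -> wf t -> gt s t ->
       gt (subst sg s) (subst sg t)) /\
  (forall s s' t' t, simB s s' -> gt s' t' -> simB t' t -> gt s t).

Inductive inf_step (gt : term F -> term F -> Prop) (E R E' R' : pairs) : Prop :=
| Deduce_peak : forall s t u,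
    rstep R u s -> rstep R u t ->
    seteq E' (add E s t) -> seteq R' R -> inf_step gt E R E' R'
| Deduce_cliff : forall s t u,
    rstep R u s -> sym_step B u t ->
    seteq E' E -> seteq R' (add R t s) -> inf_step gt E R E' R'
| Orient : forall s t,
    gt s t ->
    (E s t /\ seteq E' (remove E s t) \/ E t s /\ seteq E' (remove E t s)) ->
    seteq R' (add R s t) -> inf_step gt E R E' R'
| Delete : forall s t,
    E s t -> simB s t ->
    seteq E' (remove E s t) -> seteq R' R -> inf_step gt E R E' R'
| Simplify : forall s t u,
    rstep_mod R s u ->
    (E s t /\ seteq E' (add (remove E s t) u t) \/
     E t s /\ seteq E' (add (remove E t s) u t)) ->
    seteq R' R -> inf_step gt E R E' R'
| Collapse : forall s t u,
    R s t -> rstep (remove R s t) s u ->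
    seteq E' (add E u t) -> seteq R' (remove R s t) -> inf_step gt E R E' R'
| Compose : forall s t u,
    R s t -> rstep_mod (remove R s t) t u ->
    seteq E' E -> seteq R' (add (remove R s t) s u) -> inf_step gt E R E' R'.

Definition run (gt : term F -> term F -> Prop) (E : pairs)
    (Es Rs : nat -> pairs) (n : nat) : Prop :=
  seteq (Es 0) E /\ seteq (Rs 0) empty_pairs /\
  forall i, i < n -> inf_step gt (Es i) (Rs i) (Es (S i)) (Rs (S i)).

Definition non_failing (Es : nat -> pairs) (n : nat) : Prop :=
  forall a b, ~ Es n a b.

End ModB.

Definition renaming (pi : nat -> nat) : Prop :=
  exists pi', forall x, pi (pi' x) = x /\ pi' (pi x) = x.

Definition rename (pi : nat -> nat) : term F -> term F :=
  subst (fun x => Var (pi x)).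

Definition variant_pair (l r l' r' : term F) : Prop :=
  exists pi, renaming pi /\ l' = rename pi l /\ r' = rename pi r.

Definition variant_of (X : pairs) (l' r' : term F) : Prop :=
  exists l r, X l r /\ variant_pair l r l' r'.

Definition unifier (sg : nat -> term F) (a b : term F) : Prop :=
  subst sg a = subst sg b.

Definition mgu (sg : nat -> term F) (a b : term F) : Prop :=
  unifier sg a b /\
  forall tau, unifier tau a b ->
    exists delta, forall x, tau x = subst delta (sg x).

Definition rewrite_normal (R : pairs) (v : term F) : Prop :=
  ~ exists w, rstep R v w.

(* prime critical pairs of overlaps <l1 -> r1, p, l2 -> r2> with
   l1 -> r1 from X1 and l2 -> r2 from X2; primality w.r.t. the TRS R *)
Definition pcp_of (R X1 X2 : pairs) (a b : term F) : Prop :=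
  exists l1 r1 l2 r2 p sg f ts,
    variant_of X1 l1 r1 /\ variant_of X2 l2 r2 /\
    (forall x, In x (vars l1 ++ vars r1) -> ~ In x (vars l2 ++ vars r2)) /\
    subterm_at l2 p = Some (Fun f ts) /\
    mgu sg l1 (Fun f ts) /\
    (p = nil -> ~ variant_pair l1 r1 l2 r2) /\
    (forall q v, q <> nil -> subterm_at (subst sg l2) (p ++ q) = Some v ->
                 rewrite_normal R v) /\
    a = replace_at (subst sg l2) p (subst sg r1) /\
    b = subst sg r2.

Definition PCP (R : pairs) : pairs := pcp_of R R R.

Definition PCP_pm (R Bpm : pairs) : pairs :=
  fun a b => pcp_of R R Bpm a b \/ pcp_of R Bpm R a b.

Definition linear (t : term F) : Prop := NoDup (vars t).

Definition left_linear (R : pairs) : Prop := forall l r, R l r -> linear l.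

Definition fair (B : pairs) (Es Rs : nat -> pairs) (n : nat) : Prop :=
  left_linear (Rs n) /\
  (forall a b, PCP (Rs n) a b ->
     joinable_mod B (Rs n) a b \/
     exists i, i <= n /\ sym_step (punion (Es i) (Rs i)) a b) /\
  (forall a b, PCP_pm (Rs n) (sym_pairs B) a b ->
     joinable_mod B (Rs n) a b \/
     exists i, i <= n /\ sym_step (Rs i) a b).

Definition ES (E : pairs) : Prop := forall l r, E l r -> wf l /\ wf r.

End Terms.

(* Main.v *)
Require Import Defs.
From Stdlib Require Import List Relations Lia Wf_nat.
From Stdlib Require Import Classical ClassicalEpsilon.
Import ListNotations.

Set Implicit Arguments.

(* Every rule of the run decreases the B-compatible order, so termination modulo B is
   immediate, and each inference step turns an equation or rule into a conversion that
   stays below its two sides.  Hence a pair that was convertible in one step at some stage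
   of the run is still convertible at the end without leaving any downward closed set of
   terms, and a rule of an intermediate system still lets its left-hand side be rewritten
   by the final one, to a term convertible with the right-hand side strictly below.

   By fairness the instances of prime critical pairs are therefore closed as follows: for a
   peak s <- u -> t, s and t are convertible strictly below u; for a cliff s <- u <-> t
   with a B-step, some v with t -> v is convertible with s strictly below u.  Redexes in
   proper subterms of the overlap reduce the non-prime cases to prime ones, and for
   variable overlaps left-linearity (rule above a B-step) or equality of variables (B-step
   above a rule) suffices, so all local peaks and cliffs have these properties.

   Well-founded induction on u then shows that all R/B-normal forms reachable from u are
   B-equivalent: two first steps leaving the B-class of u are connected strictly below u by
   moving one of them along the class with cliffs and closing the resulting peak.  Since
   cliffs also make reducibility invariant under B, plain R-steps reach such a normal
   form. *)

(** * Relations *)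

Section Closures.
Variables A A' : Type.

Lemma clos_rt_lift (P : relation A) (Q : relation A') (h : A -> A') :
  (forall a b, P a b -> clos_refl_trans _ Q (h a) (h b)) ->
  forall a b, clos_refl_trans _ P a b -> clos_refl_trans _ Q (h a) (h b).
Proof.
  intros HPQ a b H; induction H.
  - auto.
  - apply rt_refl.
  - eapply rt_trans; eauto.
Qed.

Lemma clos_rt_sym (P : relation A) :
  (forall a b, P a b -> P b a) ->
  forall a b, clos_refl_trans _ P a b -> clos_refl_trans _ P b a.
Proof.
  intros HP a b H; induction H.
  - apply rt_step; auto.
  - apply rt_refl.
  - eapply rt_trans; eauto.
Qed.

Lemma NoDup_app_disjoint (l1 l2 : list A) :
  NoDup (l1 ++ l2) -> forall a, In a l1 -> ~ In a l2.
Proof.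
  induction l1 as [| b l1 IH]; simpl; intros H a []; inversion H; subst; auto.
  intros Ha; match goal with H : ~ In _ _ |- _ => apply H end.
  apply in_or_app; auto.
Qed.

(** A point that is not accessible has a predecessor that is not accessible either. Choosing such
    predecessors again and again, by classical choice, builds an infinite chain. *)
Lemma well_founded_no_chain (P : relation A) :
  ~ (exists f : nat -> A, forall i, P (f (S i)) (f i)) -> well_founded P.
Proof.
  intros Hno x0; apply NNPP; intros Hx0.
  pose (T := {x : A | ~ Acc P x}).
  assert (Hnext : forall x : T, exists y : T, P (proj1_sig y) (proj1_sig x)).
  { intros [x Hx]; apply NNPP; intros Hn; apply Hx; constructor; intros y Hy.
    apply NNPP; intros HA; apply Hn; exists (exist _ y HA); exact Hy. }
  pose (next := fun x => proj1_sig (constructive_indefinite_description _ (Hnext x))).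
  assert (Hnx : forall x, P (proj1_sig (next x)) (proj1_sig x))
    by (intros x; exact (proj2_sig (constructive_indefinite_description _ (Hnext x)))).
  apply Hno; exists (fun i => proj1_sig (Nat.iter i next (exist _ x0 Hx0))).
  intros i; apply Hnx.
Qed.

End Closures.

(** * Terms, positions and substitutions *)

Section Terms.
Variable F : Type.

(** Recursion on terms passes through the argument list, so an inner induction on that list hands
    the hypothesis to each of its members. *)
Lemma term_nested_ind (P : term F -> Prop) :
  (forall x, P (Var x)) ->
  (forall f ts, (forall t, In t ts -> P t) -> P (Fun f ts)) ->
  forall t, P t.
Proof.
  intros HV HF; fix IH 1; intros [x | f ts].
  - apply HV.
  - apply HF; induction ts as [| u ts IHts]; intros t [].
    + subst t; apply IH.
    + apply IHts; assumption.
Qed.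

Fixpoint term_size (t : term F) : nat :=
  match t with
  | Var _ => 1
  | Fun _ ts => S (list_sum (map term_size ts))
  end.

Lemma term_size_pos (t : term F) : 0 < term_size t.
Proof. destruct t; simpl; lia. Qed.

Lemma subterm_at_cons (f : F) l1 a l2 q :
  subterm_at (Fun f (l1 ++ a :: l2)) (length l1 :: q) = subterm_at a q.
Proof. simpl; rewrite nth_error_app2, PeanoNat.Nat.sub_diag by lia; reflexivity. Qed.

Lemma replace_at_cons (f : F) l1 a l2 q v :
  replace_at (Fun f (l1 ++ a :: l2)) (length l1 :: q) v =
  Fun f (l1 ++ replace_at a q v :: l2).
Proof.
  unfold replace_at at 1; fold (@replace_at F).
  rewrite nth_error_app2, PeanoNat.Nat.sub_diag by lia; simpl nth_error; cbv iota.
  rewrite firstn_app, PeanoNat.Nat.sub_diag, firstn_all, app_nil_r.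
  rewrite skipn_app, skipn_all2 by lia.
  replace (S (length l1) - length l1) with 1 by lia; reflexivity.
Qed.

(** Trades index arithmetic for a split of the argument list: inductions on positions can then
    rewrite with [subterm_at_cons] and [replace_at_cons]. *)
Lemma subterm_at_cons_inv (t : term F) i q v :
  subterm_at t (i :: q) = Some v ->
  exists f l1 a l2, t = Fun f (l1 ++ a :: l2) /\ i = length l1 /\ subterm_at a q = Some v.
Proof.
  destruct t as [x | f ts]; simpl; [discriminate |].
  destruct (nth_error ts i) as [a |] eqn:Ha; [| discriminate].
  intros Hv; destruct (nth_error_split _ _ Ha) as (l1 & l2 & -> & <-).
  exists f, l1, a, l2; auto.
Qed.

Lemma subterm_at_app (p q : list nat) : forall (t u : term F),
  subterm_at t p = Some u -> subterm_at t (p ++ q) = subterm_at u q.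
Proof.
  induction p as [| i p IH]; intros t u Hu; [injection Hu as ->; reflexivity |].
  destruct (subterm_at_cons_inv _ _ _ Hu) as (f & l1 & a & l2 & -> & -> & Ha).
  rewrite <- app_comm_cons, subterm_at_cons; auto.
Qed.

Lemma replace_at_app (p q : list nat) v : forall (t u : term F),
  subterm_at t p = Some u -> replace_at t (p ++ q) v = replace_at t p (replace_at u q v).
Proof.
  induction p as [| i p IH]; intros t u Hu; [injection Hu as ->; reflexivity |].
  destruct (subterm_at_cons_inv _ _ _ Hu) as (f & l1 & a & l2 & -> & -> & Ha).
  rewrite <- app_comm_cons, !replace_at_cons, (IH a u Ha); reflexivity.
Qed.

Lemma replace_at_self (p : list nat) : forall (t u : term F),
  subterm_at t p = Some u -> replace_at t p u = t.
Proof.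
  induction p as [| i p IH]; intros t u Hu; [injection Hu as ->; reflexivity |].
  destruct (subterm_at_cons_inv _ _ _ Hu) as (f & l1 & a & l2 & -> & -> & Ha).
  rewrite replace_at_cons, (IH a u Ha); reflexivity.
Qed.

Lemma replace_at_twice (p : list nat) v w : forall (t u : term F),
  subterm_at t p = Some u -> replace_at (replace_at t p v) p w = replace_at t p w.
Proof.
  induction p as [| i p IH]; intros t u Hu; [reflexivity |].
  destruct (subterm_at_cons_inv _ _ _ Hu) as (f & l1 & a & l2 & -> & -> & Ha).
  rewrite !replace_at_cons, (IH a u Ha); reflexivity.
Qed.

Lemma subterm_at_replace (p : list nat) v : forall (t u : term F),
  subterm_at t p = Some u -> subterm_at (replace_at t p v) p = Some v.
Proof.
  induction p as [| i p IH]; intros t u Hu; [reflexivity |].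
  destruct (subterm_at_cons_inv _ _ _ Hu) as (f & l1 & a & l2 & -> & -> & Ha).
  rewrite replace_at_cons, subterm_at_cons; eauto.
Qed.

Lemma subterm_at_parallel (t a b v : term F) i j p q :
  i <> j -> subterm_at t (i :: p) = Some a -> subterm_at t (j :: q) = Some b ->
  subterm_at (replace_at t (i :: p) v) (j :: q) = Some b.
Proof.
  intros Hij Ha Hb.
  destruct (subterm_at_cons_inv _ _ _ Ha) as (f & l1 & c & l2 & -> & -> & Hc).
  rewrite replace_at_cons; revert Hb; simpl.
  destruct (PeanoNat.Nat.lt_ge_cases j (length l1)) as [Hj | Hj].
  - rewrite !nth_error_app1 by assumption; auto.
  - rewrite !nth_error_app2 by assumption.
    destruct (j - length l1) as [| k] eqn:Hk; [lia | auto].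
Qed.

Lemma replace_at_parallel (t a b v w : term F) i j p q :
  i <> j -> subterm_at t (i :: p) = Some a -> subterm_at t (j :: q) = Some b ->
  replace_at (replace_at t (i :: p) v) (j :: q) w =
  replace_at (replace_at t (j :: q) w) (i :: p) v.
Proof.
  (* The claim is symmetric in the two positions. With [i < j] the argument list is cut at both
     indices and reassociated around whichever argument is replaced next. *)
  assert (Hlt : forall i j p q a b v w, i < j ->
    subterm_at t (i :: p) = Some a -> subterm_at t (j :: q) = Some b ->
    replace_at (replace_at t (i :: p) v) (j :: q) w =
    replace_at (replace_at t (j :: q) w) (i :: p) v).
  { clear; intros i j p q a b v w Hij Ha Hb.
    destruct (subterm_at_cons_inv _ _ _ Ha) as (f & l1 & c & l2 & -> & -> & Hc).
    destruct (subterm_at_cons_inv _ _ _ Hb) as (g & m1 & d & m2 & Heq & -> & Hd).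
    injection Heq as <- Heq.
    assert (Hm : exists m, m1 = l1 ++ c :: m /\ l2 = m ++ d :: m2).
    { apply app_eq_app in Heq; destruct Heq as (m & [[-> Hm] | [-> Hm]]).
      - rewrite length_app in Hij; lia.
      - destruct m as [| c' m]; simpl in Hm.
        + rewrite app_nil_r in Hij; lia.
        + injection Hm as <- ->; exists m; auto. }
    destruct Hm as (m & -> & ->).
    replace (l1 ++ c :: m ++ d :: m2) with ((l1 ++ c :: m) ++ d :: m2)
      by (rewrite <- app_assoc; reflexivity).
    rewrite replace_at_cons.
    replace ((l1 ++ c :: m) ++ d :: m2) with (l1 ++ c :: (m ++ d :: m2))
      by (rewrite <- app_assoc; reflexivity).
    replace ((l1 ++ c :: m) ++ replace_at d q w :: m2)
      with (l1 ++ c :: (m ++ replace_at d q w :: m2))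
      by (rewrite <- app_assoc; reflexivity).
    rewrite !replace_at_cons.
    replace (length (l1 ++ c :: m)) with (length (l1 ++ replace_at c p v :: m))
      by (rewrite !length_app; reflexivity).
    replace (l1 ++ replace_at c p v :: m ++ d :: m2)
      with ((l1 ++ replace_at c p v :: m) ++ d :: m2)
      by (rewrite <- app_assoc; reflexivity).
    rewrite replace_at_cons, <- app_assoc; reflexivity. }
  intros Hij Ha Hb; destruct (Compare_dec.lt_eq_lt_dec i j) as [[H | H] | H].
  - eauto.
  - contradiction.
  - symmetry; eauto.
Qed.

(** * Substitutions, variables and positions of instances *)

Lemma subst_ext (s s' : nat -> term F) (t : term F) :
  (forall x, In x (vars t) -> s x = s' x) -> subst s t = subst s' t.
Proof.
  induction t as [x | f ts IH] using term_nested_ind; simpl; intros H; [auto |].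
  f_equal; apply map_ext_in; intros u Hu; apply IH; [assumption |].
  intros x Hx; apply H; apply in_flat_map; eauto.
Qed.

Lemma subst_ext_inv (s s' : nat -> term F) (t : term F) :
  subst s t = subst s' t -> forall x, In x (vars t) -> s x = s' x.
Proof.
  induction t as [y | f ts IH] using term_nested_ind; simpl; intros H x Hx.
  - destruct Hx as [<- | []]; assumption.
  - injection H as H; apply in_flat_map in Hx; destruct Hx as (u & Hu & Hx).
    apply (IH u Hu); [| assumption].
    exact (ext_in_map H u Hu).
Qed.

Lemma subst_comp (s s' : nat -> term F) (t : term F) :
  subst s (subst s' t) = subst (fun x => subst s (s' x)) t.
Proof.
  induction t as [x | f ts IH] using term_nested_ind; simpl; [reflexivity |].
  f_equal; rewrite map_map; apply map_ext_in; assumption.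
Qed.

Lemma subst_Var (t : term F) : subst Var t = t.
Proof.
  induction t as [x | f ts IH] using term_nested_ind; simpl; [reflexivity |].
  f_equal; rewrite <- map_id; apply map_ext_in; assumption.
Qed.

Lemma vars_subst (s : nat -> term F) (t : term F) x :
  In x (vars (subst s t)) <-> exists y, In y (vars t) /\ In x (vars (s y)).
Proof.
  induction t as [y | f ts IH] using term_nested_ind; simpl.
  - split; [intros H; exists y; auto | intros (z & [<- | []] & H); assumption].
  - rewrite in_flat_map; split.
    + intros (v & Hv & Hx); apply in_map_iff in Hv; destruct Hv as (u & <- & Hu).
      apply (IH u Hu) in Hx; destruct Hx as (y & Hy & Hx).
      exists y; split; [apply in_flat_map; eauto | assumption].
    + intros (y & Hy & Hx); apply in_flat_map in Hy; destruct Hy as (u & Hu & Hy).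
      exists (subst s u); split; [apply in_map; assumption | apply IH; eauto].
Qed.

Lemma subterm_at_var_in (p : list nat) x : forall (t : term F),
  subterm_at t p = Some (Var x) -> In x (vars t).
Proof.
  induction p as [| i p IH]; intros t Ht; [injection Ht as ->; simpl; auto |].
  destruct (subterm_at_cons_inv _ _ _ Ht) as (f & l1 & a & l2 & -> & -> & Ha).
  apply in_flat_map; exists a; split; [apply in_elt | auto].
Qed.

Lemma in_vars_subterm_at (t : term F) x :
  In x (vars t) -> exists p, subterm_at t p = Some (Var x).
Proof.
  induction t as [y | f ts IH] using term_nested_ind; simpl; intros Hx.
  - destruct Hx as [-> | []]; exists []; reflexivity.
  - apply in_flat_map in Hx; destruct Hx as (u & Hu & Hx).
    destruct (IH u Hu Hx) as (p & Hp).
    apply in_split in Hu; destruct Hu as (l1 & l2 & ->).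
    exists (length l1 :: p); rewrite subterm_at_cons; assumption.
Qed.

Lemma vars_subterm_at (p : list nat) x : forall (t u : term F),
  subterm_at t p = Some u -> In x (vars u) -> In x (vars t).
Proof.
  intros t u Hu Hx; destruct (in_vars_subterm_at _ _ Hx) as (q & Hq).
  apply (subterm_at_var_in (p ++ q)); rewrite (subterm_at_app _ _ _ Hu); assumption.
Qed.

Lemma subterm_at_subst (s : nat -> term F) (p : list nat) : forall t u,
  subterm_at t p = Some u -> subterm_at (subst s t) p = Some (subst s u).
Proof.
  induction p as [| i p IH]; intros t u Hu; [injection Hu as ->; reflexivity |].
  destruct (subterm_at_cons_inv _ _ _ Hu) as (f & l1 & a & l2 & -> & -> & Ha).
  simpl subst; rewrite map_app; rewrite <- (length_map (subst s) l1) at 1.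
  simpl map; rewrite subterm_at_cons; auto.
Qed.

Lemma replace_at_subst (s : nat -> term F) (p : list nat) v : forall t u,
  subterm_at t p = Some u ->
  subst s (replace_at t p v) = replace_at (subst s t) p (subst s v).
Proof.
  induction p as [| i p IH]; intros t u Hu; [reflexivity |].
  destruct (subterm_at_cons_inv _ _ _ Hu) as (f & l1 & a & l2 & -> & -> & Ha).
  rewrite replace_at_cons; simpl subst; rewrite !map_app; simpl map.
  rewrite <- (length_map (subst s) l1), replace_at_cons, (IH a u Ha); reflexivity.
Qed.

(** This dichotomy separates critical overlaps (first case) from variable overlaps (second case). *)
Lemma subterm_at_subst_inv (s : nat -> term F) (p : list nat) : forall t u,
  subterm_at (subst s t) p = Some u ->
  (exists f ts, subterm_at t p = Some (Fun f ts)) \/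
  (exists p1 p2 x, p = p1 ++ p2 /\ subterm_at t p1 = Some (Var x) /\
                   subterm_at (s x) p2 = Some u).
Proof.
  induction p as [| i p IH]; intros [x | f ts] u Hu.
  - right; exists [], [], x; auto.
  - left; exists f, ts; reflexivity.
  - right; exists [], (i :: p), x; auto.
  - simpl in Hu; rewrite nth_error_map in Hu; simpl.
    destruct (nth_error ts i) as [a |] eqn:Ha; [| discriminate]; simpl in Hu.
    destruct (IH a u Hu) as [(g & us & H) | (p1 & p2 & x & -> & H1 & H2)].
    + left; eauto.
    + right; exists (i :: p1), p2, x; simpl; rewrite Ha; auto.
Qed.

Lemma subterm_at_size (p : list nat) : forall (t u : term F),
  subterm_at t p = Some u -> p <> [] -> term_size u < term_size t.
Proof.
  induction p as [| i p IH]; intros t u Hu Hp; [congruence |].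
  destruct (subterm_at_cons_inv _ _ _ Hu) as (f & l1 & a & l2 & -> & -> & Ha).
  assert (Hau : term_size u <= term_size a).
  { destruct p; [injection Ha as ->; lia |]. apply PeanoNat.Nat.lt_le_incl, IH; congruence. }
  simpl; rewrite map_app, list_sum_app; simpl; lia.
Qed.

Definition fupd (s : nat -> term F) (x : nat) (u : term F) : nat -> term F :=
  fun y => if PeanoNat.Nat.eqb y x then u else s y.

Lemma fupd_same s x u : fupd s x u x = u.
Proof. unfold fupd; rewrite PeanoNat.Nat.eqb_refl; reflexivity. Qed.

Lemma fupd_other s x u y : y <> x -> fupd s x u y = s y.
Proof. intros H; unfold fupd; apply PeanoNat.Nat.eqb_neq in H; rewrite H; reflexivity. Qed.

Lemma subst_fupd_notin s x u t : ~ In x (vars t) -> subst (fupd s x u) t = subst s t.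
Proof. intros H; apply subst_ext; intros y Hy; apply fupd_other; congruence. Qed.

(** In a linear term [p] is the only occurrence of [x], so changing the substitution at [x] changes
    the instance nowhere else. Left-linearity acts through this fact. *)
Lemma subst_fupd_linear s x u (p : list nat) : forall t,
  linear t -> subterm_at t p = Some (Var x) ->
  subst (fupd s x u) t = replace_at (subst s t) p u.
Proof.
  induction p as [| i p IH]; intros t Hlin Ht.
  - injection Ht as ->; simpl; apply fupd_same.
  - destruct (subterm_at_cons_inv _ _ _ Ht) as (f & l1 & a & l2 & -> & -> & Ha).
    unfold linear in Hlin; simpl in Hlin; rewrite flat_map_app in Hlin; simpl in Hlin.
    assert (Hx : In x (vars a)) by (eapply subterm_at_var_in; eauto).
    assert (Ha' : linear a).
    { apply NoDup_app_remove_l in Hlin; apply NoDup_app_remove_r in Hlin; assumption. }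
    assert (Hout : forall t, In t (l1 ++ l2) -> ~ In x (vars t)).
    { intros t Hin Hxt; apply in_app_or in Hin.
      destruct Hin as [Hin | Hin].
      - apply (NoDup_app_disjoint _ _ Hlin x); [apply in_flat_map; eauto | apply in_or_app; auto].
      - apply NoDup_app_remove_l in Hlin.
        apply (NoDup_app_disjoint _ _ Hlin x); [assumption | apply in_flat_map; eauto]. }
    simpl subst; rewrite !map_app; simpl map.
    rewrite <- (length_map (subst s) l1), replace_at_cons.
    rewrite (IH a Ha' Ha); f_equal; f_equal; [| f_equal];
      apply map_ext_in; intros t Hin; apply subst_fupd_notin, Hout, in_or_app; auto.
Qed.

(** * Most general unifiers *)

Definition unifies (s : nat -> term F) (L : list (term F * term F)) : Prop :=
  forall a b, In (a, b) L -> subst s a = subst s b.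

Definition mgu_list (s : nat -> term F) (L : list (term F * term F)) : Prop :=
  unifies s L /\
  forall tau, unifies tau L -> exists delta, forall x, tau x = subst delta (s x).

(** Counting left components is enough: under a unifier [tau] both sides of an equation have the
    same instance. *)
Definition instance_size (tau : nat -> term F) (L : list (term F * term F)) : nat :=
  list_sum (map (fun ab => term_size (subst tau (fst ab))) L).

Lemma unifies_cons s a b L :
  unifies s ((a, b) :: L) <-> subst s a = subst s b /\ unifies s L.
Proof.
  split.
  - intros H; split; [apply H; left; reflexivity | intros c d Hc; apply H; right; assumption].
  - intros [H1 H2] c d [Heq | Hin]; [injection Heq as <- <-; assumption | auto].
Qed.

Lemma unifies_combine s : forall ts us L,
  length ts = length us ->
  (unifies s (combine ts us ++ L) <->
   map (subst s) ts = map (subst s) us /\ unifies s L).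
Proof.
  induction ts as [| t ts IH]; intros [| u us] L Hlen; try discriminate; simpl.
  - tauto.
  - injection Hlen as Hlen; rewrite unifies_cons, (IH us L Hlen).
    split; [intros (-> & -> & H); auto | intros (H1 & H2); injection H1; auto].
Qed.

Lemma instance_size_combine tau L : forall ts us, length ts = length us ->
  instance_size tau (combine ts us ++ L) =
  list_sum (map term_size (map (subst tau) ts)) + instance_size tau L.
Proof.
  unfold instance_size; induction ts as [| t ts IH]; intros [| u us] Hlen;
    try discriminate; simpl in *; [reflexivity |].
  rewrite IH by lia; lia.
Qed.

(* Fixing one unifier [tau], every step of the unification algorithm decreases the
   size of the [tau]-instance of the problem, so no measure counting variables
   is needed. *)
Lemma mgu_list_exists (tau : nat -> term F) : forall N L,
  instance_size tau L < N -> unifies tau L -> exists s, mgu_list s L.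
Proof.
  induction N as [| N IH]; intros L HN Htau; [lia |].
  assert (Hvar : forall x t L', unifies tau ((Var x, t) :: L') ->
            instance_size tau L' < N -> exists s, mgu_list s ((Var x, t) :: L')).
  { clear L HN Htau; intros x t L Htau HN; apply unifies_cons in Htau.
    destruct Htau as [Hx HL]; simpl in Hx.
    destruct (classic (t = Var x)) as [-> | Htx].
    { destruct (IH L HN HL) as (s & Hs1 & Hs2); exists s; split.
      - apply unifies_cons; auto.
      - intros tau' H; apply unifies_cons in H; apply Hs2, H. }
    (* Occurs check: if [x] were properly inside [t], its [tau]-instance would be a proper subterm
       of itself, which sizes forbid. *)
    assert (Hocc : ~ In x (vars t)).
    { intros Hin; apply in_vars_subterm_at in Hin; destruct Hin as (p & Hp).
      assert (Hp' := subterm_at_subst tau _ _ Hp); rewrite <- Hx in Hp'; simpl in Hp'.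
      destruct p as [| i p]; [injection Hp as ->; congruence |].
      apply subterm_at_size in Hp'; [lia | congruence]. }
    pose (th := fupd Var x t).
    (* Every solution of [x = t] absorbs the binding [th]; this holds for [tau] and for each
       competing unifier. *)
    assert (Hth : forall s, s x = subst s t -> forall y, subst s (th y) = s y).
    { intros s Hs y; unfold th; destruct (PeanoNat.Nat.eq_dec y x) as [-> | Hy].
      - rewrite fupd_same; auto.
      - rewrite fupd_other by assumption; reflexivity. }
    pose (L' := map (fun ab => (subst th (fst ab), subst th (snd ab))) L).
    assert (HL' : forall s, unifies s L' <-> unifies (fun y => subst s (th y)) L).
    { intros s; unfold L', unifies; split.
      - intros H a b Hab; rewrite <- !subst_comp; apply H.
        apply (in_map (fun ab => (subst th (fst ab), subst th (snd ab))) _ _ Hab).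
      - intros H a b Hab; apply in_map_iff in Hab.
        destruct Hab as ((c & d) & Heq & Hin); injection Heq as <- <-; simpl.
        rewrite !subst_comp; auto. }
    assert (HLs : forall s, s x = subst s t -> unifies s L -> unifies s L').
    { intros s Hs HsL; apply HL'; intros a b Hab.
      rewrite !(@subst_ext (fun y => subst s (th y)) s); auto. }
    destruct (IH L') as (s & Hs1 & Hs2).
    (* Since [tau] absorbs [th], applying the binding to the remaining problem leaves its measure
       unchanged. *)
    - replace (instance_size tau L') with (instance_size tau L); [assumption |].
      unfold instance_size, L'; rewrite map_map; f_equal; apply map_ext; intros ab.
      f_equal; simpl; rewrite subst_comp; apply subst_ext; intros; symmetry; auto.
    - auto.
    - exists (fun y => subst s (th y)); split.
      + apply unifies_cons; split; [| apply HL'; assumption].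
        simpl; unfold th at 1; rewrite fupd_same, <- subst_comp; f_equal.
        unfold th; rewrite subst_fupd_notin by assumption; symmetry; apply subst_Var.
      + intros tau' H; apply unifies_cons in H; destruct H as [H1 H2].
        destruct (Hs2 tau') as (delta & Hd); [auto |].
        exists delta; intros y; rewrite subst_comp, <- (Hth tau') by assumption.
        apply subst_ext; auto. }
  destruct L as [| (a & b) L].
  { exists Var; split; [intros a b [] | intros tau' _; exists tau'; reflexivity]. }
  assert (HLN : instance_size tau L < N).
  { unfold instance_size in *; simpl in HN.
    assert (H := term_size_pos (subst tau a)); lia. }
  destruct a as [x | f ts]; [auto |].
  destruct b as [x | g us].
  - destruct (Hvar x (Fun f ts) L) as (s & Hs1 & Hs2); [| assumption |].
    + apply unifies_cons in Htau; apply unifies_cons; destruct Htau; auto.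
    + exists s; split.
      * apply unifies_cons in Hs1; apply unifies_cons; destruct Hs1; auto.
      * intros tau' H; apply Hs2; apply unifies_cons in H; apply unifies_cons; destruct H; auto.
  - apply unifies_cons in Htau; destruct Htau as [Hfg HL]; simpl in Hfg.
    injection Hfg as -> Hmap.
    assert (Hlen : length ts = length us)
      by (rewrite <- (length_map (subst tau)), Hmap, length_map; reflexivity).
    (* Decomposition drops the common root symbol, which lowers the measure by exactly one. *)
    destruct (IH (combine ts us ++ L)) as (s & Hs1 & Hs2).
    + rewrite instance_size_combine by assumption.
      unfold instance_size in HN |- *; simpl in HN; lia.
    + apply unifies_combine; auto.
    + exists s; split.
      * apply unifies_combine in Hs1; [| assumption]; apply unifies_cons; simpl.
        destruct Hs1 as [-> ?]; auto.
      * intros tau' H; apply Hs2; apply unifies_combine; [assumption |].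
        apply unifies_cons in H; destruct H as [H ?]; injection H; auto.
Qed.

Lemma mgu_exists (tau : nat -> term F) a b : unifier tau a b -> exists s, mgu s a b.
Proof.
  intros H; destruct (@mgu_list_exists tau _ [(a, b)] (PeanoNat.Nat.lt_succ_diag_r _))
    as (s & Hs1 & Hs2).
  - intros c d [Heq | []]; injection Heq as <- <-; assumption.
  - exists s; split; [apply Hs1; left; reflexivity |].
    intros tau' H'; apply Hs2; intros c d [Heq | []]; injection Heq as <- <-; assumption.
Qed.

End Terms.

(** * Rewriting on well-formed terms *)

Section Rewriting.
Variable F : Type.
Variable ar : F -> nat.

Lemma wf_Fun f ts : wf ar (Fun f ts) <-> length ts = ar f /\ forall t, In t ts -> wf ar t.
Proof.
  simpl; apply and_iff_compat_l; induction ts as [| u ts IH]; simpl.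
  - firstorder.
  - rewrite IH; split.
    + intros [H1 H2] t [<- | H]; auto.
    + auto.
Qed.

Lemma wf_subterm_at (p : list nat) : forall t u,
  wf ar t -> subterm_at t p = Some u -> wf ar u.
Proof.
  induction p as [| i p IH]; intros t u Ht Hu; [injection Hu as ->; assumption |].
  destruct (subterm_at_cons_inv _ _ _ Hu) as (f & l1 & a & l2 & -> & -> & Ha).
  apply (IH a); [| assumption]; apply wf_Fun in Ht; apply Ht, in_elt.
Qed.

Lemma wf_replace_at (p : list nat) v : forall t u,
  wf ar t -> subterm_at t p = Some u -> wf ar v -> wf ar (replace_at t p v).
Proof.
  induction p as [| i p IH]; intros t u Ht Hu Hv; [assumption |].
  destruct (subterm_at_cons_inv _ _ _ Hu) as (f & l1 & a & l2 & -> & -> & Ha).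
  rewrite replace_at_cons; apply wf_Fun in Ht; apply wf_Fun.
  rewrite length_app in *; destruct Ht as [Hlen Ht]; split; [assumption |].
  intros t Hin; apply in_app_or in Hin; destruct Hin as [Hin | [<- | Hin]].
  - apply Ht, in_or_app; auto.
  - apply (IH a u); auto; apply Ht, in_elt.
  - apply Ht, in_or_app; right; right; assumption.
Qed.

Lemma wf_subst s t : (forall x, In x (vars t) -> wf ar (s x)) -> wf ar t -> wf ar (subst s t).
Proof.
  induction t as [x | f ts IH] using term_nested_ind; intros Hs Ht.
  - apply Hs; simpl; auto.
  - simpl subst; apply wf_Fun in Ht; apply wf_Fun; rewrite length_map.
    destruct Ht as [Hlen Ht]; split; [assumption |].
    intros u Hu; apply in_map_iff in Hu; destruct Hu as (t & <- & Hin).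
    apply IH; auto; intros x Hx; apply Hs; simpl; apply in_flat_map; eauto.
Qed.

Lemma wf_subst_inv s t :
  wf ar (subst s t) -> wf ar t /\ forall x, In x (vars t) -> wf ar (s x).
Proof.
  induction t as [x | f ts IH] using term_nested_ind; intros H.
  - split; [exact I | intros y [<- | []]; exact H].
  - simpl subst in H; apply wf_Fun in H; rewrite length_map in H.
    destruct H as [Hlen H]; split.
    + apply wf_Fun; split; [assumption |]; intros t Hin; apply IH; auto.
      apply H, in_map; assumption.
    + simpl; intros x Hx; apply in_flat_map in Hx; destruct Hx as (t & Hin & Hx).
      apply (IH t Hin); [apply H, in_map |]; assumption.
Qed.

(* Resets junk values of a substitution at variables outside the term of interest. *)
Definition wf_total (s : nat -> term F) : nat -> term F :=
  fun x => if excluded_middle_informative (wf ar (s x)) then s x else Var x.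

Lemma wf_total_wf s x : wf ar (wf_total s x).
Proof.
  unfold wf_total; destruct (excluded_middle_informative _); [assumption | exact I].
Qed.

Lemma subst_wf_total s t : wf ar (subst s t) -> subst (wf_total s) t = subst s t.
Proof.
  intros H; apply wf_subst_inv in H; apply subst_ext; intros x Hx.
  unfold wf_total; destruct (excluded_middle_informative _); [reflexivity |].
  exfalso; apply n; apply H; assumption.
Qed.

(** A step only asks its two ends to be well-formed. The instances of both sides of the rule are
    subterms of these ends, so the rule is well-formed too, and so is the substitution once reset
    outside the rule's variables. *)
Lemma rstep_elim X s t : rstep ar X s t ->
  wf ar s /\ wf ar t /\
  exists l r p sg, X l r /\ subterm_at s p = Some (subst sg l) /\
    t = replace_at s p (subst sg r) /\ wf ar l /\ wf ar r /\ forall x, wf ar (sg x).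
Proof.
  intros (Hs & Ht & l & r & p & sg & HX & Hp & ->).
  split; [assumption | split; [assumption |]].
  assert (Hl : wf ar (subst sg l)) by (eapply wf_subterm_at; [exact Hs | eassumption]).
  assert (Hr : wf ar (subst sg r))
    by (eapply wf_subterm_at; [exact Ht | eapply subterm_at_replace; eauto]).
  exists l, r, p, (wf_total sg); rewrite !subst_wf_total by assumption.
  split; [assumption | split; [assumption | split; [reflexivity |]]].
  split; [apply (wf_subst_inv _ _ Hl) | split; [apply (wf_subst_inv _ _ Hr) |]].
  apply wf_total_wf.
Qed.

Lemma rstep_wf X s t : rstep ar X s t -> wf ar s /\ wf ar t.
Proof. intros (Hs & Ht & _); auto. Qed.

Lemma rstep_mono (X Y : pairs F) s t :
  (forall a b, X a b -> Y a b) -> rstep ar X s t -> rstep ar Y s t.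
Proof.
  intros HXY (Hs & Ht & l & r & p & sg & HX & H).
  split; [assumption | split; [assumption |]].
  exists l, r, p, sg; auto.
Qed.

Lemma rstep_root (X : pairs F) sg l r :
  X l r -> wf ar l -> wf ar r -> (forall x, wf ar (sg x)) ->
  rstep ar X (subst sg l) (subst sg r).
Proof.
  intros HX Hl Hr Hsg; split; [apply wf_subst; auto |].
  split; [apply wf_subst; auto |].
  exists l, r, [], sg; auto.
Qed.

Lemma rstep_ctx X C p u s t :
  wf ar C -> subterm_at C p = Some u ->
  rstep ar X s t -> rstep ar X (replace_at C p s) (replace_at C p t).
Proof.
  intros HC Hp (Hs & Ht & l & r & q & sg & HX & Hq & ->).
  split; [eapply wf_replace_at; eauto | split; [eapply wf_replace_at; eauto |]].
  exists l, r, (p ++ q), sg; split; [assumption |].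
  assert (Hp' := subterm_at_replace p s C Hp).
  rewrite (subterm_at_app _ _ _ Hp'), (replace_at_app _ _ _ _ Hp').
  split; [assumption | symmetry; eapply replace_at_twice; eauto].
Qed.

Lemma rstep_subst X d s t :
  (forall x, wf ar (d x)) -> rstep ar X s t -> rstep ar X (subst d s) (subst d t).
Proof.
  intros Hd (Hs & Ht & l & r & q & sg & HX & Hq & ->).
  split; [apply wf_subst; auto | split; [apply wf_subst; auto |]].
  exists l, r, q, (fun x => subst d (sg x)); split; [assumption |].
  rewrite <- !subst_comp; split; [apply subterm_at_subst; assumption |].
  eapply replace_at_subst; eauto.
Qed.

Lemma rstep_at X s p sg l r :
  X l r -> wf ar s -> wf ar r -> (forall x, wf ar (sg x)) ->
  subterm_at s p = Some (subst sg l) -> rstep ar X s (replace_at s p (subst sg r)).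
Proof.
  intros HX Hs Hr Hsg Hp; split; [assumption |].
  split; [eapply wf_replace_at; eauto; apply wf_subst; auto |].
  exists l, r, p, sg; auto.
Qed.

Lemma sym_step_sym X s t : sym_step ar X s t -> sym_step ar X t s.
Proof. unfold sym_step; tauto. Qed.

Lemma sym_step_wf X s t : sym_step ar X s t -> wf ar s /\ wf ar t.
Proof. intros [H | H]; apply rstep_wf in H; tauto. Qed.

Lemma sym_step_mono (X Y : pairs F) s t :
  (forall a b, X a b -> Y a b) -> sym_step ar X s t -> sym_step ar Y s t.
Proof. intros HXY [H | H]; [left | right]; eapply rstep_mono; eauto. Qed.

Lemma sym_step_ctx X C p u s t :
  wf ar C -> subterm_at C p = Some u ->
  sym_step ar X s t -> sym_step ar X (replace_at C p s) (replace_at C p t).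
Proof. intros HC Hp [H | H]; [left | right]; eapply rstep_ctx; eauto. Qed.

Lemma sym_step_subst X d s t :
  (forall x, wf ar (d x)) -> sym_step ar X s t -> sym_step ar X (subst d s) (subst d t).
Proof. intros Hd [H | H]; [left | right]; apply rstep_subst; auto. Qed.

Lemma conv_sym X s t : conv ar X s t -> conv ar X t s.
Proof. apply clos_rt_sym; apply sym_step_sym. Qed.

Lemma conv_trans X s t u : conv ar X s t -> conv ar X t u -> conv ar X s u.
Proof. apply rt_trans. Qed.

Lemma conv_refl X s : conv ar X s s.
Proof. apply rt_refl. Qed.

Lemma rstep_conv X s t : rstep ar X s t -> conv ar X s t.
Proof. intros H; apply rt_step; left; assumption. Qed.

Lemma conv_wf X s t : conv ar X s t -> (wf ar s <-> wf ar t).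
Proof.
  intros H; induction H; [| tauto | tauto].
  apply sym_step_wf in H; tauto.
Qed.

Lemma conv_mono (X Y : pairs F) s t :
  (forall a b, X a b -> Y a b) -> conv ar X s t -> conv ar Y s t.
Proof.
  intros HXY; apply (clos_rt_lift (fun x => x)).
  intros a b H; apply rt_step; eapply sym_step_mono; eauto.
Qed.

Lemma conv_ctx X C p u s t :
  wf ar C -> subterm_at C p = Some u ->
  conv ar X s t -> conv ar X (replace_at C p s) (replace_at C p t).
Proof.
  intros HC Hp; apply (clos_rt_lift (replace_at C p)).
  intros a b H; apply rt_step; eapply sym_step_ctx; eauto.
Qed.

Lemma conv_subst X d s t :
  (forall x, wf ar (d x)) -> conv ar X s t -> conv ar X (subst d s) (subst d t).
Proof.
  intros Hd; apply (clos_rt_lift (subst d)).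
  intros a b H; apply rt_step; apply sym_step_subst; auto.
Qed.

Lemma conv_of_pairs (X Y : pairs F) s t :
  (forall l r, X l r -> conv ar Y l r) -> conv ar X s t -> conv ar Y s t.
Proof.
  intros HXY; apply (clos_rt_lift (fun x => x)); intros a b H.
  assert (Hstep : forall a b, rstep ar X a b -> conv ar Y a b).
  { clear a b H; intros a b H; apply rstep_elim in H.
    destruct H as (Ha & _ & l & r & p & sg & HX & Hp & -> & _ & _ & Hsg).
    rewrite <- (replace_at_self _ _ Hp) at 1.
    eapply conv_ctx; [assumption | eassumption |].
    apply conv_subst; auto. }
  destruct H as [H | H]; [exact (Hstep _ _ H) | exact (conv_sym (Hstep _ _ H))].
Qed.

Lemma rewrites_subst X d s t :
  (forall x, wf ar (d x)) -> clos_refl_trans _ (rstep ar X) s t ->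
  clos_refl_trans _ (rstep ar X) (subst d s) (subst d t).
Proof.
  intros Hd; apply (clos_rt_lift (subst d)).
  intros a b H; apply rt_step; apply rstep_subst; auto.
Qed.

(** The variable instances are changed one argument at a time, each inside a context. The relation
    is left abstract so that the result serves both [R]-steps and [B]-steps. *)
Lemma ctx_closed_subst (P : relation (term F)) (s s' : nat -> term F) t :
  (forall C p u a b, wf ar C -> subterm_at C p = Some u -> P a b ->
     P (replace_at C p a) (replace_at C p b)) ->
  wf ar t -> (forall x, wf ar (s x)) -> (forall x, wf ar (s' x)) ->
  (forall x, In x (vars t) -> clos_refl_trans _ P (s x) (s' x)) ->
  clos_refl_trans _ P (subst s t) (subst s' t).
Proof.
  intros HP Ht Hs Hs'; induction t as [x | f ts IH] using term_nested_ind; intros H.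
  - apply H; simpl; auto.
  - apply wf_Fun in Ht; destruct Ht as [Hlen Ht]; simpl in H |- *.
    assert (Hall : forall t, In t ts -> clos_refl_trans _ P (subst s t) (subst s' t)).
    { intros t Hin; apply IH; auto; intros x Hx; apply H, in_flat_map; eauto. }
    (* [done] holds the arguments already moved to [s'], [rest] those still under [s]. *)
    enough (Hgen : forall done rest,
              length (done ++ map (subst s) rest) = ar f ->
              (forall t, In t done -> wf ar t) ->
              (forall t, In t rest -> wf ar t) ->
              (forall t, In t rest -> clos_refl_trans _ P (subst s t) (subst s' t)) ->
              clos_refl_trans _ P (Fun f (done ++ map (subst s) rest))
                                  (Fun f (done ++ map (subst s') rest))).
    { apply (Hgen [] ts); simpl; auto; [rewrite length_map; assumption | intros t []]. }
    intros done rest; revert done.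
    induction rest as [| t rest IHr]; intros done Hl Hd Hr Hc; simpl; [apply rt_refl |].
    apply rt_trans with (Fun f (done ++ subst s' t :: map (subst s) rest)).
    + pose (C := Fun f (done ++ subst s t :: map (subst s) rest)).
      assert (HCp : subterm_at C [length done] = Some (subst s t))
        by (unfold C; rewrite subterm_at_cons; reflexivity).
      assert (HCr : forall v, replace_at C [length done] v =
                              Fun f (done ++ v :: map (subst s) rest))
        by (intros v; unfold C; rewrite replace_at_cons; reflexivity).
      rewrite <- !HCr.
      apply (@clos_rt_lift _ _ P P (replace_at C [length done]));
        [| apply Hc; simpl; auto].
      intros a b Hab; apply rt_step; eapply HP; eauto.
      apply wf_Fun; split; [assumption |].
      intros u Hu; apply in_app_or in Hu; destruct Hu as [Hu | [<- | Hu]]; auto.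
      * apply wf_subst; auto; apply Hr; simpl; auto.
      * apply in_map_iff in Hu; destruct Hu as (v & <- & Hv).
        apply wf_subst; auto; apply Hr; simpl; auto.
    + replace (done ++ subst s' t :: map (subst s) rest)
        with ((done ++ [subst s' t]) ++ map (subst s) rest)
        by (rewrite <- app_assoc; reflexivity).
      replace (done ++ subst s' t :: map (subst s') rest)
        with ((done ++ [subst s' t]) ++ map (subst s') rest)
        by (rewrite <- app_assoc; reflexivity).
      apply IHr.
      * rewrite <- Hl, <- app_assoc, !length_app; reflexivity.
      * intros u Hu; apply in_app_or in Hu; destruct Hu as [Hu | [<- | []]]; auto.
        apply wf_subst; auto; apply Hr; simpl; auto.
      * intros u Hu; apply Hr; simpl; auto.
      * intros u Hu; apply Hc; simpl; auto.
Qed.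

(** After one occurrence of [x] has been changed to [v], the other occurrences catch up; this
    completes variable overlaps when [t] is not linear. *)
Lemma ctx_closed_fupd (P : relation (term F)) (s : nat -> term F) x v p : forall t,
  (forall C p u a b, wf ar C -> subterm_at C p = Some u -> P a b ->
     P (replace_at C p a) (replace_at C p b)) ->
  wf ar t -> (forall y, wf ar (s y)) -> wf ar v -> P (s x) v ->
  subterm_at t p = Some (Var x) ->
  clos_refl_trans _ P (replace_at (subst s t) p v) (subst (fupd s x v) t).
Proof.
  intros t HP Ht Hs Hv Hxv Hp.
  assert (Hs' : forall y, wf ar (fupd s x v y)).
  { intros y; unfold fupd; destruct (PeanoNat.Nat.eqb y x); auto. }
  assert (Hss : forall y, clos_refl_trans _ P (s y) (fupd s x v y)).
  { intros y; destruct (PeanoNat.Nat.eq_dec y x) as [-> | Hy].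
    - rewrite fupd_same; apply rt_step; assumption.
    - rewrite fupd_other by assumption; apply rt_refl. }
  (* Renaming the occurrence at [p] to a fresh variable [z] reduces the claim to
     [ctx_closed_subst]. *)
  pose (z := S (list_sum (vars t) + x)).
  assert (Hz : forall y, In y (vars t) -> y <> z).
  { intros y Hy; assert (y <= list_sum (vars t)); [| unfold z; lia].
    clear - Hy; induction (vars t) as [| w L IH]; [destruct Hy |].
    destruct Hy as [-> | Hy]; simpl; [| apply IH in Hy]; lia. }
  pose (t' := replace_at t p (Var z)).
  assert (Hsub : forall s0, subst (fupd s0 z v) t' = replace_at (subst s0 t) p v).
  { intros s0; unfold t'; rewrite (replace_at_subst _ _ _ _ Hp); simpl.
    rewrite fupd_same, subst_fupd_notin; [reflexivity |].
    intros H; apply Hz in H; congruence. }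
  rewrite <- Hsub.
  replace (subst (fupd s x v) t) with (subst (fupd (fupd s x v) z v) t').
  (* Under the updated substitution the subterm at [p] already is [v], so putting [v] there changes
     nothing. *)
  2:{ rewrite Hsub; apply replace_at_self.
      rewrite (subterm_at_subst _ _ _ Hp); simpl; rewrite fupd_same; reflexivity. }
  apply ctx_closed_subst; auto.
  - unfold t'; eapply wf_replace_at; [eassumption | eassumption | exact I].
  - intros y; unfold fupd at 1; destruct (PeanoNat.Nat.eqb y z); auto.
  - intros y; unfold fupd at 1; destruct (PeanoNat.Nat.eqb y z); auto.
  - intros y _; destruct (PeanoNat.Nat.eq_dec y z) as [-> | Hy].
    + rewrite !fupd_same; apply rt_refl.
    + rewrite !(@fupd_other _ _ z) by assumption; apply Hss.
Qed.

End Rewriting.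

(** * Conversions inside a set of terms *)

Section ConvIn.
Variable F : Type.
Variable ar : F -> nat.

(** Taking for [D] the terms below the source of a peak gives the usual notion of connectedness
    below that source. The empty conversion puts no condition on its single term. *)
Definition conv_in (X : pairs F) (D : term F -> Prop) : relation (term F) :=
  clos_refl_trans _ (fun a b => sym_step ar X a b /\ D a /\ D b).

Lemma conv_in_refl X D s : conv_in X D s s.
Proof. apply rt_refl. Qed.

Lemma conv_in_trans X D s t u : conv_in X D s t -> conv_in X D t u -> conv_in X D s u.
Proof. apply rt_trans. Qed.

Lemma conv_in_sym X D s t : conv_in X D s t -> conv_in X D t s.
Proof.
  apply clos_rt_sym; intros a b (H & Ha & Hb).
  split; [apply sym_step_sym |]; auto.
Qed.

Lemma conv_in_step X (D : term F -> Prop) s t :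
  sym_step ar X s t -> D s -> D t -> conv_in X D s t.
Proof. intros; apply rt_step; auto. Qed.

Lemma conv_in_mono (X Y : pairs F) (D D' : term F -> Prop) s t :
  (forall a b, X a b -> Y a b) -> (forall a, D a -> D' a) ->
  conv_in X D s t -> conv_in Y D' s t.
Proof.
  intros HXY HD; apply (clos_rt_lift (fun x => x)).
  intros a b (H & Ha & Hb); apply rt_step; split; [eapply sym_step_mono |]; eauto.
Qed.

Lemma conv_in_ctx X (D D' : term F -> Prop) C p u s t :
  wf ar C -> subterm_at C p = Some u -> (forall a, D a -> D' (replace_at C p a)) ->
  conv_in X D s t -> conv_in X D' (replace_at C p s) (replace_at C p t).
Proof.
  intros HC Hp HD; apply (clos_rt_lift (replace_at C p)).
  intros a b (H & Ha & Hb); apply rt_step; split; [eapply sym_step_ctx |]; eauto.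
Qed.

Lemma conv_in_subst X (D D' : term F -> Prop) d s t :
  (forall x, wf ar (d x)) -> (forall a, D a -> D' (subst d a)) ->
  conv_in X D s t -> conv_in X D' (subst d s) (subst d t).
Proof.
  intros Hd HD; apply (clos_rt_lift (subst d)).
  intros a b (H & Ha & Hb); apply rt_step; split; [apply sym_step_subst |]; auto.
Qed.

Lemma conv_in_conv X D s t : conv_in X D s t -> conv ar X s t.
Proof.
  apply (clos_rt_lift (fun x => x)); intros a b (H & _); apply rt_step; assumption.
Qed.

Lemma conv_conv_in X (D : term F -> Prop) s t :
  conv ar X s t -> (forall a, conv ar X s a -> D a) -> conv_in X D s t.
Proof.
  intros H; induction H; intros HD.
  - apply rt_step; split; [assumption | split; apply HD; [apply rt_refl | apply rt_step]; auto].
  - apply rt_refl.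
  - apply rt_trans with y; [apply IHclos_refl_trans1, HD |].
    apply IHclos_refl_trans2; intros a Ha; apply HD.
    apply rt_trans with y; assumption.
Qed.

Lemma rewrites_conv_in X (D : term F -> Prop) s t :
  clos_refl_trans _ (rstep ar X) s t ->
  (forall a, clos_refl_trans _ (rstep ar X) s a -> D a) -> conv_in X D s t.
Proof.
  intros H; induction H; intros HD.
  - apply conv_in_step; [left; assumption | apply HD, rt_refl | apply HD, rt_step; assumption].
  - apply rt_refl.
  - apply rt_trans with y; [apply IHclos_refl_trans1, HD |].
    apply IHclos_refl_trans2; intros a Ha; apply HD.
    apply rt_trans with y; assumption.
Qed.

End ConvIn.

(** * Reduction orders compatible with B *)

Section Order.
Variable F : Type.
Variable ar : F -> nat.
Variable B : pairs F.
Variable gt : term F -> term F -> Prop.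
Hypothesis Hgt : B_compatible_reduction_order ar B gt.

Notation simB := (simB ar B).

(* The axioms of a reduction order constrain [gt] on well-formed terms only. *)
Definition gtw (s t : term F) : Prop := wf ar s /\ wf ar t /\ gt s t.

(** The quasi-order belonging to the order and its equivalence [simB]; compatibility with [B] makes
    it transitive. *)
Definition geq (s t : term F) : Prop := gtw s t \/ simB s t.

Lemma gtw_trans s t u : gtw s t -> gtw t u -> gtw s u.
Proof.
  destruct Hgt as (_ & Htr & _); intros (? & ? & ?) (? & ? & ?).
  unfold gtw; eauto.
Qed.

Lemma gtw_irrefl s : ~ gtw s s.
Proof. destruct Hgt as (Hir & _); intros (H & _ & Hs); exact (Hir s H Hs). Qed.

Lemma gtw_ctx C p u s t :
  wf ar C -> subterm_at C p = Some u -> gtw s t ->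
  gtw (replace_at C p s) (replace_at C p t).
Proof.
  destruct Hgt as (_ & _ & _ & Hctx & _); intros HC Hp (Hs & Ht & Hst).
  split; [eapply wf_replace_at; eauto | split; [eapply wf_replace_at; eauto |]].
  apply Hctx; auto; congruence.
Qed.

Lemma gtw_subst d s t :
  (forall x, wf ar (d x)) -> gtw s t -> gtw (subst d s) (subst d t).
Proof.
  destruct Hgt as (_ & _ & _ & _ & Hsub & _); intros Hd (Hs & Ht & Hst).
  split; [apply wf_subst; auto | split; [apply wf_subst; auto | auto]].
Qed.

Lemma gtw_sim s s' t' t : simB s s' -> gtw s' t' -> simB t' t -> gtw s t.
Proof.
  destruct Hgt as (_ & _ & _ & _ & _ & Hsim); intros Hs (Hws & Hwt & Hst) Ht.
  split; [apply (conv_wf Hs); assumption |].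
  split; [apply (conv_wf Ht); assumption | eauto].
Qed.

Lemma gtw_not_sim s t : gtw s t -> ~ simB s t.
Proof.
  intros H Hs; apply (@gtw_irrefl s).
  apply (@gtw_sim s s t s); [apply conv_refl | assumption | apply conv_sym; assumption].
Qed.

Lemma gtw_wf : well_founded (fun s t => gtw t s).
Proof.
  apply well_founded_no_chain; intros (f & Hf).
  destruct Hgt as (_ & _ & Hno & _); apply Hno.
  exists f; intros i; destruct (Hf i) as (? & ? & ?); auto.
Qed.

Lemma geq_refl s : geq s s.
Proof. right; apply conv_refl. Qed.

Lemma gtw_geq_trans s t u : gtw s t -> geq t u -> gtw s u.
Proof.
  intros H [H' | H']; [eapply gtw_trans; eauto |].
  eapply gtw_sim; [apply conv_refl | eassumption | assumption].
Qed.

Lemma geq_gtw_trans s t u : geq s t -> gtw t u -> gtw s u.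
Proof.
  intros [H' | H'] H; [eapply gtw_trans; eauto |].
  eapply gtw_sim; [eassumption | eassumption | apply conv_refl].
Qed.

Lemma geq_trans s t u : geq s t -> geq t u -> geq s u.
Proof.
  intros [H | H] H'; [left; eapply gtw_geq_trans; eauto |].
  destruct H' as [H' | H']; [left; eapply geq_gtw_trans; [right |]; eauto |].
  right; eapply conv_trans; eauto.
Qed.

Lemma geq_ctx C p u s t :
  wf ar C -> subterm_at C p = Some u -> geq s t ->
  geq (replace_at C p s) (replace_at C p t).
Proof.
  intros HC Hp [H | H]; [left; eapply gtw_ctx; eauto | right; eapply conv_ctx; eauto].
Qed.

Lemma geq_subst d s t :
  (forall x, wf ar (d x)) -> geq s t -> geq (subst d s) (subst d t).
Proof.
  intros Hd [H | H]; [left; apply gtw_subst; auto | right; apply conv_subst; auto].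
Qed.

(* Iterating [t > C[t]] gives an infinite descent. *)
Lemma gtw_no_embedding C p u t :
  wf ar C -> subterm_at C p = Some u -> ~ gtw t (replace_at C p t).
Proof.
  intros HC Hp Ht; destruct Hgt as (_ & _ & Hno & _); apply Hno.
  exists (fun i => Nat.iter i (replace_at C p) t).
  enough (H : forall i, gtw (Nat.iter i (replace_at C p) t)
                            (Nat.iter (S i) (replace_at C p) t))
    by (intros i; destruct (H i) as (? & ? & ?); auto).
  induction i as [| i IH]; [assumption |].
  simpl; eapply gtw_ctx; eauto.
Qed.

(** Were [x] only in [r], substituting [l] for [x] would keep [l] and embed it in the instance of
    [r], so [l] would exceed a context around itself. This yields the variable condition on the
    rules of a run. *)
Lemma gtw_vars l r : gtw l r -> forall x, In x (vars r) -> In x (vars l).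
Proof.
  intros Hlr x Hr; apply NNPP; intros Hl.
  destruct Hlr as (Hwl & Hwr & H).
  assert (Hd : forall y, wf ar (fupd Var x l y)).
  { intros y; unfold fupd; destruct (PeanoNat.Nat.eqb y x); [assumption | exact I]. }
  assert (Hlr : gtw (subst (fupd Var x l) l) (subst (fupd Var x l) r))
    by (apply gtw_subst; [assumption | split; auto]).
  rewrite subst_fupd_notin, subst_Var in Hlr by assumption.
  apply in_vars_subterm_at in Hr; destruct Hr as (p & Hp).
  apply (subterm_at_subst (fupd Var x l)) in Hp; simpl in Hp; rewrite fupd_same in Hp.
  apply (@gtw_no_embedding (subst (fupd Var x l) r) p l l); auto.
  - apply wf_subst; auto.
  - rewrite (replace_at_self _ _ Hp); assumption.
Qed.

(** * Oriented rule sets, downward closed sets and conversions bounded by their ends *)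

Definition ordered (R : pairs F) : Prop := forall l r, R l r -> gtw l r.

Lemma rstep_gtw R s t : ordered R -> rstep ar R s t -> gtw s t.
Proof.
  intros HR H; apply rstep_elim in H.
  destruct H as (Hs & _ & l & r & p & sg & HX & Hp & -> & _ & _ & Hsg).
  rewrite <- (replace_at_self _ _ Hp) at 1.
  eapply gtw_ctx; [assumption | eassumption | apply gtw_subst; auto].
Qed.

Lemma rstep_mod_gtw R s t : ordered R -> rstep_mod ar B R s t -> gtw s t.
Proof.
  intros HR (s' & t' & Hs & H & Ht); eapply gtw_sim; eauto; eapply rstep_gtw; eauto.
Qed.

Lemma rewrites_geq R s t : ordered R -> clos_refl_trans _ (rstep ar R) s t -> geq s t.
Proof.
  intros HR H; induction H.
  - left; eapply rstep_gtw; eauto.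
  - apply geq_refl.
  - eapply geq_trans; eauto.
Qed.

Definition down_closed (D : term F -> Prop) : Prop := forall a b, D a -> geq a b -> D b.

Lemma down_closed_gtw s : down_closed (gtw s).
Proof. intros a b; apply gtw_geq_trans. Qed.

(** Bounding a conversion by its own two ends is stable under contexts and substitutions, and such a
    conversion can replace a step inside any downward closed set containing both ends. *)
Definition conv_dom (X : pairs F) (s t : term F) : Prop :=
  conv_in ar X (fun a => geq s a \/ geq t a) s t.

Lemma conv_dom_in X D s t : conv_dom X s t -> down_closed D -> D s -> D t -> conv_in ar X D s t.
Proof.
  intros H HD Hs Ht; revert H; apply conv_in_mono; [auto |].
  intros a [Ha | Ha]; [exact (HD _ _ Hs Ha) | exact (HD _ _ Ht Ha)].
Qed.

Lemma conv_dom_sym X s t : conv_dom X s t -> conv_dom X t s.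
Proof.
  intros H; apply conv_in_sym; revert H; apply conv_in_mono; tauto.
Qed.

Lemma conv_dom_rstep (X Y : pairs F) s t :
  (forall l r, X l r -> conv_dom Y l r) -> sym_step ar X s t -> conv_dom Y s t.
Proof.
  intros HXY H.
  assert (Hstep : forall a b, rstep ar X a b -> conv_dom Y a b).
  { clear s t H; intros a b H; apply rstep_elim in H.
    destruct H as (Ha & _ & l & r & p & sg & HX & Hp & -> & _ & _ & Hsg).
    rewrite <- (replace_at_self _ _ Hp) at 1.
    unfold conv_dom.
    apply (@conv_in_ctx _ ar Y (fun c => geq (subst sg l) c \/ geq (subst sg r) c)
             _ a p _ _ _ Ha Hp).
    - intros c [Hc | Hc]; [left | right]; eapply geq_ctx; eauto.
    - apply (@conv_in_subst _ ar Y (fun c => geq l c \/ geq r c)); [assumption | | apply HXY; auto].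
      intros c [Hc | Hc]; [left | right]; apply geq_subst; auto. }
  destruct H as [H | H]; [exact (Hstep _ _ H) | exact (conv_dom_sym (Hstep _ _ H))].
Qed.

Lemma conv_dom_conv_in (X Y : pairs F) D s t :
  (forall l r, X l r -> conv_dom Y l r) -> down_closed D ->
  conv_in ar X D s t -> conv_in ar Y D s t.
Proof.
  intros HXY HD; apply (clos_rt_lift (fun x => x)).
  intros a b (H & Ha & Hb).
  exact (conv_dom_in (conv_dom_rstep HXY H) HD Ha Hb).
Qed.

Lemma conv_in_sim (X : pairs F) (D : term F -> Prop) s t :
  (forall a b, B a b -> X a b) -> down_closed D -> D s -> simB s t -> conv_in ar X D s t.
Proof.
  intros HX HD Hs Hst; apply (@conv_in_mono _ ar B X D D); auto.
  apply conv_conv_in; [assumption |]; intros a Ha; apply (HD s); [assumption | right; assumption].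
Qed.

Lemma conv_in_rewrites R (X : pairs F) (D : term F -> Prop) s t :
  ordered R -> (forall a b, R a b -> X a b) -> down_closed D -> D s ->
  clos_refl_trans _ (rstep ar R) s t -> conv_in ar X D s t.
Proof.
  intros HR HX HD Hs Hst; apply (@conv_in_mono _ ar R X D D); auto.
  apply rewrites_conv_in; [assumption |]; intros a Ha; apply (HD s); [assumption |].
  eapply rewrites_geq; eauto.
Qed.

Lemma conv_in_rstep_mod R (X : pairs F) (D : term F -> Prop) s t :
  ordered R -> (forall a b, R a b \/ B a b -> X a b) -> down_closed D -> D s ->
  rstep_mod ar B R s t -> conv_in ar X D s t.
Proof.
  intros HR HX HD Hs (s' & t' & Hs' & H & Ht).
  assert (Ds' : D s') by (apply (HD s); [assumption | right; assumption]).
  assert (Dt' : D t') by (apply (HD s'); [assumption | left; eapply rstep_gtw; eauto]).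
  apply conv_in_trans with s'; [apply conv_in_sim; auto |].
  apply conv_in_trans with t'; [| apply conv_in_sim; auto].
  apply conv_in_step; auto; left; eapply rstep_mono; [| eassumption]; auto.
Qed.

Lemma conv_in_joinable R (X : pairs F) (D : term F -> Prop) s t :
  ordered R -> (forall a b, R a b \/ B a b -> X a b) -> down_closed D -> D s -> D t ->
  joinable_mod ar B R s t -> conv_in ar X D s t.
Proof.
  intros HR HX HD Hs Ht (u & v & Hu & Huv & Hv).
  apply conv_in_trans with u; [eapply conv_in_rewrites; eauto |].
  apply conv_in_trans with v; [| apply conv_in_sym; eapply conv_in_rewrites; eauto].
  apply conv_in_sim; auto; apply (HD s); [assumption | eapply rewrites_geq; eauto].
Qed.

(** * Runs *)

Definition eqns (E R : pairs F) : pairs F := punion (punion E R) B.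

Lemma conv_dom_pair (X : pairs F) s t : X s t -> wf ar s -> wf ar t -> conv_dom X s t.
Proof.
  intros HX Hs Ht; apply conv_in_step; [| left | right]; try apply geq_refl.
  left; rewrite <- (subst_Var s), <- (subst_Var t); apply rstep_root; auto.
  intros; exact I.
Qed.

Lemma ordered_remove R s t : ordered R -> ordered (Defs.remove R s t).
Proof. intros HR l r [H _]; auto. Qed.

Lemma inf_step_invariant E R E' R' :
  inf_step ar B gt E R E' R' -> ES ar E -> ordered R -> ES ar E' /\ ordered R'.
Proof.
  intros Hstep HE HR.
  assert (HRwf : forall l r, R l r -> wf ar l /\ wf ar r)
    by (intros l r H; destruct (HR l r H) as (? & ? & _); auto).
  destruct Hstep as
    [s t u H1 H2 HE' HR' | s t u H1 H2 HE' HR' | s t H1 HE' HR' | s t H1 H2 HE' HR'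
    | s t u H1 HE' HR' | s t u H1 H2 HE' HR' | s t u H1 H2 HE' HR'].
  - split; intros l r H; [apply HE' in H | apply HR' in H; auto].
    destruct H as [H | [-> ->]]; [auto |].
    apply rstep_wf in H1; apply rstep_wf in H2; tauto.
  - split; intros l r H; [apply HE' in H; auto | apply HR' in H].
    destruct H as [H | [-> ->]]; [auto |].
    (* The new rule is oriented because [t] is equivalent to [u] and [u] is greater than [s]. *)
    apply (@gtw_sim t u s s).
    + apply rt_step, sym_step_sym; assumption.
    + eapply rstep_gtw; eauto.
    + apply conv_refl.
  - assert (Hst : wf ar s /\ wf ar t)
      by (destruct HE' as [(H & _) | (H & _)]; apply HE in H; tauto).
    split; intros l r H.
    + destruct HE' as [(_ & HE') | (_ & HE')]; apply HE' in H; apply HE, H.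
    + apply HR' in H; destruct H as [H | [-> ->]]; [auto |].
      split; [| split]; tauto.
  - split; intros l r H; [apply HE' in H; apply HE, H | apply HR' in H; auto].
  - assert (Hst : wf ar s /\ wf ar t)
      by (destruct HE' as [(H & _) | (H & _)]; apply HE in H; tauto).
    split; intros l r H; [| apply HR' in H; auto].
    destruct HE' as [(_ & HE') | (_ & HE')]; apply HE' in H;
      (destruct H as [[H _] | [-> ->]]; [auto |]);
      destruct (rstep_mod_gtw HR H1) as (_ & ? & _); tauto.
  - split; intros l r H.
    + apply HE' in H; destruct H as [H | [-> ->]]; [auto |].
      apply rstep_wf in H2; apply HRwf in H1; tauto.
    + apply HR' in H; destruct H as [H _]; auto.
  - split; intros l r H; [apply HE' in H; auto |].
    apply HR' in H; destruct H as [[H _] | [-> ->]]; [auto |].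
    apply gtw_trans with t; [auto |].
    eapply rstep_mod_gtw; [| eassumption]; apply ordered_remove; assumption.
Qed.

Lemma remove_cases (X : pairs F) s t l r : X l r -> Defs.remove X s t l r \/ (l = s /\ r = t).
Proof. intros H; unfold Defs.remove; destruct (classic (l = s /\ r = t)); auto. Qed.

Lemma down_closed_geq s t : down_closed (fun a => geq s a \/ geq t a).
Proof. intros a b [H | H] Hab; [left | right]; eapply geq_trans; eauto. Qed.

Hypothesis HBwf : ES ar B.

(** A pair removed by an inference is recovered from what replaces it, using only terms at or below
    its two sides, because rewriting a side makes it smaller. *)
Lemma inf_step_complete E R E' R' :
  inf_step ar B gt E R E' R' -> ES ar E -> ordered R ->
  forall l r, eqns E R l r -> conv_dom (eqns E' R') l r.
Proof.
  intros Hstep HE HR.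
  destruct (inf_step_invariant Hstep HE HR) as [HEw' HRw'].
  assert (Hkeep : forall l r, eqns E' R' l r -> conv_dom (eqns E' R') l r).
  { intros l r H; apply conv_dom_pair; [assumption | |];
      destruct H as [[H | H] | H];
      (apply HEw' in H || (apply HRw' in H; destruct H as (? & ? & _)) || apply HBwf in H);
      tauto. }
  assert (HXE : forall a b, E' a b -> eqns E' R' a b) by (unfold eqns, punion; auto).
  assert (HXR : forall a b, R' a b -> eqns E' R' a b) by (unfold eqns, punion; auto).
  assert (HXB : forall a b, B a b -> eqns E' R' a b) by (unfold eqns, punion; auto).
  assert (HXRB : forall a b, R' a b \/ B a b -> eqns E' R' a b)
    by (unfold eqns, punion; tauto).
  (* Common core of Simplify, Collapse and Compose: [u] is below [s], so continuing from [u] to [t]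
     respects the bound given by [s] and [t]. *)
  assert (Hsimp : forall s t u, rstep_mod ar B R' s u -> conv_dom (eqns E' R') u t ->
             conv_dom (eqns E' R') s t).
  { intros s t u Hsu Hut; assert (Hgt' := rstep_mod_gtw HRw' Hsu).
    apply conv_in_trans with u.
    - eapply conv_in_rstep_mod; eauto using down_closed_geq; left; apply geq_refl.
    - apply (conv_dom_in Hut); auto using down_closed_geq.
      + left; left; assumption.
      + right; apply geq_refl. }
  assert (Hmod : forall (X : pairs F) s u, rstep ar X s u -> rstep_mod ar B X s u)
    by (intros X s u H; exists s, u; split; [apply conv_refl | split; [assumption | apply conv_refl]]).
  assert (Hmono : forall (X : pairs F) s u, (forall a b, X a b -> R' a b) ->
            rstep_mod ar B X s u -> rstep_mod ar B R' s u).
  { intros X s u HX (s' & u' & H1 & H2 & H3); exists s', u'.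
    split; [assumption | split; [eapply rstep_mono; eauto | assumption]]. }
  destruct Hstep as
    [s t u H1 H2 HE' HR' | s t u H1 H2 HE' HR' | s t H1 HE' HR' | s t H1 H2 HE' HR'
    | s t u H1 HE' HR' | s t u H1 H2 HE' HR' | s t u H1 H2 HE' HR'];
    intros l r [[H | H] | H]; try (apply Hkeep, HXB; assumption).
  - apply Hkeep, HXE, HE'; left; assumption.
  - apply Hkeep, HXR, HR'; assumption.
  - apply Hkeep, HXE, HE'; assumption.
  - apply Hkeep, HXR, HR'; left; assumption.
  - destruct HE' as [(_ & HE') | (_ & HE')].
    + destruct (remove_cases _ s t _ _ H) as [Hr | [-> ->]].
      * apply Hkeep, HXE, HE'; assumption.
      * apply Hkeep, HXR, HR'; right; auto.
    + destruct (remove_cases _ t s _ _ H) as [Hr | [-> ->]].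
      * apply Hkeep, HXE, HE'; assumption.
      * apply conv_dom_sym, Hkeep, HXR, HR'; right; auto.
  - apply Hkeep, HXR, HR'; left; assumption.
  - destruct (remove_cases _ s t _ _ H) as [Hr | [-> ->]].
    + apply Hkeep, HXE, HE'; assumption.
    + apply conv_in_sim; auto using down_closed_geq; left; apply geq_refl.
  - apply Hkeep, HXR, HR'; assumption.
  - assert (Hsu : rstep_mod ar B R' s u)
      by (apply (Hmono R); [intros a b; apply HR' | assumption]).
    destruct HE' as [(_ & HE') | (_ & HE')].
    + destruct (remove_cases _ s t _ _ H) as [Hr | [-> ->]].
      * apply Hkeep, HXE, HE'; left; assumption.
      * apply (Hsimp _ _ _ Hsu), Hkeep, HXE, HE'; right; auto.
    + destruct (remove_cases _ t s _ _ H) as [Hr | [-> ->]].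
      * apply Hkeep, HXE, HE'; left; assumption.
      * apply conv_dom_sym, (Hsimp _ _ _ Hsu), Hkeep, HXE, HE'; right; auto.
  - apply Hkeep, HXR, HR'; assumption.
  - apply Hkeep, HXE, HE'; left; assumption.
  - destruct (remove_cases _ s t _ _ H) as [Hr | [-> ->]].
    + apply Hkeep, HXR, HR'; assumption.
    + apply (@Hsimp s t u).
      (* The collapsing step uses rules other than the collapsed one, and these survive in [R']. *)
      * apply (@Hmono (Defs.remove R s t)); [intros a b; apply HR' | auto].
      * apply Hkeep, HXE, HE'; right; auto.
  - apply Hkeep, HXE, HE'; assumption.
  - destruct (remove_cases _ s t _ _ H) as [Hr | [-> ->]].
    + apply Hkeep, HXR, HR'; left; assumption.
    (* Compose rewrites the right-hand side, so the pair is reversed before and after using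
       [Hsimp]. *)
    + apply conv_dom_sym, (@Hsimp t s u).
      * apply (@Hmono (Defs.remove R s t)); [intros a b Hab; apply HR'; left; assumption | auto].
      * apply conv_dom_sym, Hkeep, HXR, HR'; right; auto.
Qed.

Lemma pair_conv (X : pairs F) s t : X s t -> wf ar s -> wf ar t -> conv ar X s t.
Proof. intros; eapply conv_in_conv, conv_dom_pair; eauto. Qed.

Lemma pair_rstep (X : pairs F) s t : X s t -> wf ar s -> wf ar t -> rstep ar X s t.
Proof.
  intros; rewrite <- (subst_Var s), <- (subst_Var t); apply rstep_root; auto.
  intros; exact I.
Qed.

(** Each new pair is a consequence of old ones. No bound on the intermediate terms is recorded, as
    this direction serves only to compare the equational theories. *)
Lemma inf_step_sound E R E' R' :
  inf_step ar B gt E R E' R' -> ES ar E -> ordered R ->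
  forall l r, eqns E' R' l r -> conv ar (eqns E R) l r.
Proof.
  intros Hstep HE HR.
  assert (HXE : forall a b, E a b -> eqns E R a b) by (unfold eqns, punion; auto).
  assert (HXR : forall a b, R a b -> eqns E R a b) by (unfold eqns, punion; auto).
  assert (HXB : forall a b, B a b -> eqns E R a b) by (unfold eqns, punion; auto).
  assert (Hkeep : forall l r, eqns E R l r -> conv ar (eqns E R) l r).
  { intros l r H; apply pair_conv; [assumption | |];
      destruct H as [[H | H] | H];
      (apply HE in H || (apply HR in H; destruct H as (? & ? & _)) || apply HBwf in H);
      tauto. }
  assert (Hsim : forall s t, simB s t -> conv ar (eqns E R) s t)
    by (intros s t; apply conv_mono; assumption).
  assert (Hrs : forall (X : pairs F) s t, (forall a b, X a b -> R a b) ->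
            rstep ar X s t -> conv ar (eqns E R) s t)
    by (intros X s t HX H; apply rstep_conv; eapply rstep_mono; [| eassumption]; auto).
  assert (Hmod : forall (X : pairs F) s t, (forall a b, X a b -> R a b) ->
            rstep_mod ar B X s t -> conv ar (eqns E R) s t).
  { intros X s t HX (s' & t' & H1 & H2 & H3).
    apply conv_trans with s'; [auto |]; apply conv_trans with t'; [eauto | auto]. }
  assert (Hrem : forall s t a b, Defs.remove R s t a b -> R a b) by (intros s t a b []; auto).
  destruct Hstep as
    [s t u H1 H2 HE' HR' | s t u H1 H2 HE' HR' | s t H1 HE' HR' | s t H1 H2 HE' HR'
    | s t u H1 HE' HR' | s t u H1 H2 HE' HR' | s t u H1 H2 HE' HR'];
    intros l r [[H | H] | H]; try (apply Hkeep, HXB; assumption).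
  - apply HE' in H; destruct H as [H | [-> ->]]; [apply Hkeep, HXE; assumption |].
    apply conv_trans with u; [apply conv_sym |]; eapply Hrs; eauto.
  - apply Hkeep, HXR, HR'; assumption.
  - apply Hkeep, HXE, HE'; assumption.
  - apply HR' in H; destruct H as [H | [-> ->]]; [apply Hkeep, HXR; assumption |].
    apply conv_trans with u; [| eapply Hrs; eauto].
    apply Hsim, conv_sym, rt_step; assumption.
  - destruct HE' as [(_ & HE') | (_ & HE')]; apply HE' in H; apply Hkeep, HXE, H.
  - apply HR' in H; destruct H as [H | [-> ->]]; [apply Hkeep, HXR; assumption |].
    destruct HE' as [(H & _) | (H & _)].
    + apply Hkeep, HXE; assumption.
    + apply conv_sym, Hkeep, HXE; assumption.
  - apply HE' in H; apply Hkeep, HXE, H.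
  - apply Hkeep, HXR, HR'; assumption.
  - assert (Hus : conv ar (eqns E R) u s) by (apply conv_sym; eapply Hmod; eauto).
    destruct HE' as [(Hst & HE') | (Hst & HE')]; apply HE' in H;
      (destruct H as [[H _] | [-> ->]]; [apply Hkeep, HXE; assumption |]);
      apply conv_trans with s; auto.
    apply conv_sym; auto.
  - apply Hkeep, HXR, HR'; assumption.
  - apply HE' in H; destruct H as [H | [-> ->]]; [apply Hkeep, HXE; assumption |].
    apply conv_trans with s; [| auto].
    apply conv_sym; eapply Hrs; [| eassumption]; eauto.
  - apply HR' in H; apply Hkeep, HXR, H.
  - apply Hkeep, HXE, HE'; assumption.
  - apply HR' in H; destruct H as [[H _] | [-> ->]]; [apply Hkeep, HXR; assumption |].
    apply conv_trans with t; [auto |]; eapply Hmod; [| eassumption]; eauto.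
Qed.

(* The stronger form for rules: the left-hand side stays reducible.  Cliffs need it, as
   for [s <- u ~ t] the step that is closed must leave [t], which is not below [u]. *)
Lemma inf_step_rule E R E' R' :
  inf_step ar B gt E R E' R' -> ES ar E -> ordered R ->
  forall l r, R l r ->
  exists v, rstep ar R' l v /\ conv_in ar (eqns E' R') (gtw l) v r.
Proof.
  intros Hstep HE HR l r Hlr.
  destruct (inf_step_invariant Hstep HE HR) as [HEw' HRw'].
  assert (Hgtlr := HR l r Hlr).
  assert (Hkeep : R' l r ->
            exists v, rstep ar R' l v /\ conv_in ar (eqns E' R') (gtw l) v r).
  { intros H; exists r; split; [| apply conv_in_refl].
    destruct Hgtlr as (? & ? & _); apply pair_rstep; auto. }
  destruct Hstep as
    [s t u H1 H2 HE' HR' | s t u H1 H2 HE' HR' | s t H1 HE' HR' | s t H1 H2 HE' HR'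
    | s t u H1 HE' HR' | s t u H1 H2 HE' HR' | s t u H1 H2 HE' HR'].
  - apply Hkeep, HR'; assumption.
  - apply Hkeep, HR'; left; assumption.
  - apply Hkeep, HR'; left; assumption.
  - apply Hkeep, HR'; assumption.
  - apply Hkeep, HR'; assumption.
  - destruct (remove_cases _ s t _ _ Hlr) as [Hr | [-> ->]]; [apply Hkeep, HR'; assumption |].
    assert (H3 : rstep ar R' s u) by (eapply rstep_mono; [| exact H2]; apply HR').
    exists u; split; [assumption |].
    assert (Hsu := rstep_gtw HRw' H3).
    (* Collapse: both [u] and [t] are below [s], so the new equation connects them there. *)
    apply (@conv_dom_in (eqns E' R') (gtw s)); auto using down_closed_gtw.
    destruct Hsu as (_ & ? & _); destruct Hgtlr as (_ & ? & _).
    apply conv_dom_pair; auto; left; left; apply HE'; right; auto.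
  - destruct (remove_cases _ s t _ _ Hlr) as [Hr | [-> ->]]; [apply Hkeep, HR'; left; assumption |].
    assert (Hsu : gtw s u).
    { apply gtw_trans with t; [assumption |].
      eapply rstep_mod_gtw; [| eassumption]; apply ordered_remove; assumption. }
    exists u; split.
    + destruct Hsu as (? & ? & _); apply pair_rstep; auto; apply HR'; right; auto.
    (* Compose: the new rule leads from [s] to [u], and the step from [t] to [u] is read backwards
       below [s]. *)
    + apply conv_in_sym; apply (@conv_in_rstep_mod (Defs.remove R s t));
        auto using down_closed_gtw, ordered_remove.
      intros a b [Hab | Hab]; [left; right; apply HR'; left | right]; assumption.
Qed.

Lemma inf_step_rstep E R E' R' :
  inf_step ar B gt E R E' R' -> ES ar E -> ordered R ->
  forall s t, rstep ar R s t ->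
  exists v, rstep ar R' s v /\ conv_in ar (eqns E' R') (gtw s) v t.
Proof.
  intros Hstep HE HR s t H; apply rstep_elim in H.
  destruct H as (Hs & _ & l & r & p & sg & Hlr & Hp & -> & _ & _ & Hsg).
  destruct (inf_step_rule Hstep HE HR _ _ Hlr) as (v & Hv & Hvr).
  exists (replace_at s p (subst sg v)); rewrite <- (replace_at_self _ _ Hp) at 1; split.
  - eapply rstep_ctx; eauto; apply rstep_subst; assumption.
  - apply (@conv_in_ctx _ ar _ (gtw (subst sg l)) _ s p (subst sg l)); auto.
    + intros a Ha; rewrite <- (replace_at_self _ _ Hp) at 1; eapply gtw_ctx; eauto.
    + apply (@conv_in_subst _ ar _ (gtw l)); auto.
      intros a; apply gtw_subst; assumption.
Qed.

(** * Whole runs: transporting conversions and steps to the last stage *)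

Section Run.
Variables (E : pairs F) (Es Rs : nat -> pairs F) (n : nat).
Hypothesis HE : ES ar E.
Hypothesis Hrun : run ar B gt E Es Rs n.

Lemma run_invariant i : i <= n -> ES ar (Es i) /\ ordered (Rs i).
Proof.
  destruct Hrun as (HE0 & HR0 & Hsteps); induction i as [| i IH]; intros Hi.
  - split; intros l r H; [apply HE, HE0; assumption | destruct (proj1 (HR0 l r) H)].
  - destruct IH as [IHE IHR]; [lia |].
    exact (inf_step_invariant (Hsteps i Hi) IHE IHR).
Qed.

Lemma run_conv_iff i : i <= n ->
  forall s t, conv ar (punion E B) s t <-> conv ar (eqns (Es i) (Rs i)) s t.
Proof.
  induction i as [| i IH]; intros Hi s t.
  - destruct Hrun as (HE0 & HR0 & _).
    split; apply conv_mono; intros a b; unfold eqns, punion.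
    + intros [H | H]; [left; left; apply HE0 |]; auto.
    + intros [[H | H] | H]; [left; apply HE0; assumption | | auto].
      destruct (proj1 (HR0 a b) H).
  - rewrite IH by lia.
    destruct Hrun as (_ & _ & Hsteps).
    destruct (@run_invariant i) as [HEi HRi]; [lia |].
    split; apply conv_of_pairs; intros l r H.
    + eapply conv_in_conv, (inf_step_complete (Hsteps i Hi)); assumption.
    + apply (inf_step_sound (Hsteps i Hi)); assumption.
Qed.

Lemma run_conv_in k i D s t : i + k = n -> down_closed D ->
  conv_in ar (eqns (Es i) (Rs i)) D s t -> conv_in ar (eqns (Es n) (Rs n)) D s t.
Proof.
  revert i; induction k as [| k IH]; intros i Hi HD H.
  - replace n with i by lia; assumption.
  - apply (IH (S i)); [lia | assumption |].
    destruct (@run_invariant i) as [HEi HRi]; [lia |].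
    destruct Hrun as (_ & _ & Hsteps); revert H; apply conv_dom_conv_in; [| assumption].
    apply (inf_step_complete (Hsteps i ltac:(lia))); assumption.
Qed.

Lemma run_rstep k i s t : i + k = n -> rstep ar (Rs i) s t ->
  exists v, rstep ar (Rs n) s v /\ conv_in ar (eqns (Es n) (Rs n)) (gtw s) v t.
Proof.
  revert i t; induction k as [| k IH]; intros i t Hi H.
  - replace n with i by lia; exists t; split; [assumption | apply conv_in_refl].
  - destruct (@run_invariant i) as [HEi HRi]; [lia |].
    assert (Hstep := proj2 (proj2 Hrun) i ltac:(lia)).
    destruct (inf_step_rstep Hstep HEi HRi H) as (v & Hv & Hvt).
    destruct (IH (S i) v) as (w & Hw & Hwv); [lia | assumption |].
    (* The part from [w] to [v] is already final; the part from [v] to [t] belongs to stage [S i]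
       and is still to be transported. *)
    exists w; split; [assumption | apply conv_in_trans with v; [assumption |]].
    apply (@run_conv_in k (S i)); [lia | apply down_closed_gtw | assumption].
Qed.

End Run.

End Order.

(** * Critical pairs *)

Section CriticalPairs.
Variable F : Type.
Variable ar : F -> nat.

Definition prime_at (R : pairs F) (u : term F) (p : list nat) : Prop :=
  forall q v, q <> [] -> subterm_at u (p ++ q) = Some v -> rewrite_normal ar R v.

(** Swaps the blocks below [N] and from [N] to [2N]. Renamings must be bijective, so a plain
    translation by [N] would not do. *)
Definition shift (N x : nat) : nat :=
  if Nat.ltb x N then x + N else if Nat.ltb x (N + N) then x - N else x.

Lemma shift_involutive N x : shift N (shift N x) = x.
Proof.
  unfold shift; destruct (PeanoNat.Nat.ltb_spec x N).
  - destruct (PeanoNat.Nat.ltb_spec (x + N) N); [lia |].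
    destruct (PeanoNat.Nat.ltb_spec (x + N) (N + N)); lia.
  - destruct (PeanoNat.Nat.ltb_spec x (N + N)).
    + destruct (PeanoNat.Nat.ltb_spec (x - N) N); lia.
    + destruct (PeanoNat.Nat.ltb_spec x N); [lia |].
      destruct (PeanoNat.Nat.ltb_spec x (N + N)); lia.
Qed.

Lemma in_list_sum (L : list nat) x : In x L -> x <= list_sum L.
Proof.
  induction L as [| y L IH]; simpl; [tauto |].
  intros [-> | H]; [| apply IH in H]; lia.
Qed.

Lemma variant_pair_refl (l r : term F) : variant_pair l r l r.
Proof.
  exists (fun x => x); split; [exists (fun x => x); auto |].
  unfold rename; rewrite !subst_Var; auto.
Qed.

(* The first disjunct covers overlaps of variants at the root, which
   [pcp_of] excludes. *)
Lemma critical_instance (R X1 X2 : pairs F) l1 r1 l2 r2 s1 s2 p f ts :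
  X1 l1 r1 -> X2 l2 r2 ->
  (forall x, In x (vars r1) -> In x (vars l1)) ->
  (forall x, wf ar (s1 x)) -> (forall x, wf ar (s2 x)) ->
  subterm_at l2 p = Some (Fun f ts) -> subst s1 l1 = subst s2 (Fun f ts) ->
  prime_at R (subst s2 l2) p ->
  replace_at (subst s2 l2) p (subst s1 r1) = subst s2 r2 \/
  exists a b d, pcp_of ar R X1 X2 a b /\ (forall x, wf ar (d x)) /\
    subst d a = replace_at (subst s2 l2) p (subst s1 r1) /\ subst d b = subst s2 r2.
Proof.
  intros H1 H2 Hv1 Hs1 Hs2 Hp Huni Hprime.
  pose (N := S (list_sum ((vars l1 ++ vars r1) ++ vars l2 ++ vars r2))).
  assert (HN : forall x, In x ((vars l1 ++ vars r1) ++ vars l2 ++ vars r2) -> x < N)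
    by (intros x Hx; apply in_list_sum in Hx; unfold N; lia).
  assert (HN1 : forall x, In x (vars l1 ++ vars r1) -> x < N)
    by (intros x Hx; apply HN, in_or_app; auto).
  assert (HN2 : forall x, In x (vars l2 ++ vars r2) -> x < N)
    by (intros x Hx; apply HN, in_or_app; auto).
  pose (l1' := rename (shift N) l1); pose (r1' := rename (shift N) r1).
  (* Variables below [N] belong to the second rule, those from [N] on to the shifted copy of the
     first, so one substitution can play both [s1] and [s2]. *)
  pose (tau := fun x => if Nat.ltb x N then s2 x else s1 (x - N)).
  assert (Htau : forall x, wf ar (tau x))
    by (intros x; unfold tau; destruct (Nat.ltb x N); auto).
  assert (Htau1 : forall t, (forall x, In x (vars t) -> x < N) ->
            subst tau (rename (shift N) t) = subst s1 t).
  { intros t Ht; unfold rename; rewrite subst_comp; apply subst_ext; intros x Hx.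
    apply Ht in Hx; simpl; unfold tau, shift.
    destruct (PeanoNat.Nat.ltb_spec x N); [| lia].
    destruct (PeanoNat.Nat.ltb_spec (x + N) N); [lia | f_equal; lia]. }
  assert (Htau2 : forall t, (forall x, In x (vars t) -> x < N) ->
            subst tau t = subst s2 t).
  { intros t Ht; apply subst_ext; intros x Hx; apply Ht in Hx; unfold tau.
    destruct (PeanoNat.Nat.ltb_spec x N); [reflexivity | lia]. }
  assert (Hl1 : subst tau l1' = subst s1 l1)
    by (apply Htau1; intros x Hx; apply HN1, in_or_app; auto).
  assert (Hr1 : subst tau r1' = subst s1 r1)
    by (apply Htau1; intros x Hx; apply HN1, in_or_app; auto).
  assert (Hl2 : subst tau l2 = subst s2 l2)
    by (apply Htau2; intros x Hx; apply HN2, in_or_app; auto).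
  assert (Hr2 : subst tau r2 = subst s2 r2)
    by (apply Htau2; intros x Hx; apply HN2, in_or_app; auto).
  assert (Hf : subst tau (Fun f ts) = subst s2 (Fun f ts)).
  { apply Htau2; intros x Hx; apply HN2, in_or_app; left.
    exact (vars_subterm_at _ _ _ Hp Hx). }
  destruct (@mgu_exists F tau l1' (Fun f ts)) as (sg & Hsg).
  { unfold unifier; congruence. }
  destruct (proj2 Hsg tau) as (d0 & Hd0); [unfold unifier; congruence |].
  (* The factor [d0] may be ill-formed at variables that occur in no [sg x]. *)
  pose (d := wf_total ar d0).
  assert (Hd : forall t, subst d (subst sg t) = subst tau t).
  { intros t; rewrite subst_comp; apply subst_ext; intros x _.
    rewrite Hd0; apply subst_wf_total; rewrite <- Hd0; auto. }
  destruct (classic (p = [] /\ variant_pair l1' r1' l2 r2)) as [[Hnil Hvar] | Hnv].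
  (* For variants at the root the two instances agree on the variables of the left-hand side, hence
     on those of the right-hand side, and the reducts coincide. *)
  - left; subst p; simpl in Hp; injection Hp as Hp.
    destruct Hvar as (pi & _ & Heql & Heqr); simpl.
    rewrite <- Hr1, <- Hr2, Heqr; unfold rename; rewrite subst_comp.
    assert (Heq : subst tau l1' = subst (fun x => subst tau (Var (pi x))) l1')
      by (rewrite <- subst_comp; change (subst tau l1' = subst tau (rename pi l1'));
          rewrite <- Heql; congruence).
    apply subst_ext; intros x Hx; apply (subst_ext_inv _ _ _ Heq).
    unfold r1', l1', rename in *; rewrite vars_subst in *.
    destruct Hx as (y & Hy & Hx); exists y; auto.
  - right; exists (replace_at (subst sg l2) p (subst sg r1')), (subst sg r2), d.
    split; [| split; [apply wf_total_wf | split]].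
    + exists l1', r1', l2, r2, p, sg, f, ts.
      split.
      { exists l1, r1; split; [assumption |]; exists (shift N); split; [| auto].
        exists (shift N); intros x; split; apply shift_involutive. }
      split; [exists l2, r2; split; [assumption | apply variant_pair_refl] |].
      split.
      { intros x Hx1 Hx2; apply HN2 in Hx2.
        assert (Hx : exists y, y < N /\ x = shift N y).
        { apply in_app_or in Hx1; unfold l1', r1', rename in Hx1.
          rewrite !vars_subst in Hx1.
          destruct Hx1 as [(y & Hy & [<- | []]) | (y & Hy & [<- | []])];
            exists y; split; try reflexivity; apply HN1, in_or_app; auto. }
        destruct Hx as (y & Hy & ->); unfold shift in Hx2.
        destruct (PeanoNat.Nat.ltb_spec y N); lia. }
      split; [assumption | split; [assumption | split; [tauto | split; [| auto]]]].
      (* A redex in the most general overlap would survive instantiation by [d] and contradict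
         primality of the given one. *)
      intros q v Hq Hv (w & Hw).
      apply (subterm_at_subst d) in Hv; rewrite Hd, Hl2 in Hv.
      apply (Hprime q _ Hq Hv); exists (subst d w).
      apply rstep_subst; [apply wf_total_wf | assumption].
    + rewrite (replace_at_subst _ _ _ _ (subterm_at_subst sg _ _ Hp)), !Hd; congruence.
    + rewrite Hd; assumption.
Qed.

(** By induction on size: pass to a reducible proper subterm while there is one; when there is none,
    the redex sits at the root and is prime. *)
Lemma innermost_redex R v : (exists w, rstep ar R v w) ->
  exists q l r sg, R l r /\ wf ar r /\ (forall x, wf ar (sg x)) /\
    subterm_at v q = Some (subst sg l) /\ prime_at R v q.
Proof.
  remember (term_size v) as N eqn:HN; revert v HN.
  induction N as [N IH] using lt_wf_ind; intros v -> Hred.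
  destruct (classic (exists q w, q <> [] /\ subterm_at v q = Some w /\
                                 exists w', rstep ar R w w')) as [Hin | Hno].
  - destruct Hin as (q & w & Hq & Hw & Hred').
    destruct (IH (term_size w) (subterm_at_size _ Hw Hq) w eq_refl Hred')
      as (q' & l & r & sg & HR & Hr & Hsg & Hl & Hprime).
    exists (q ++ q'), l, r, sg; rewrite (subterm_at_app _ _ _ Hw).
    split; [assumption | split; [assumption | split; [assumption | split; [assumption |]]]].
    intros q'' w'' Hq''; rewrite <- app_assoc, (subterm_at_app _ _ _ Hw).
    exact (Hprime q'' w'' Hq'').
  - destruct Hred as (w & Hw); apply rstep_elim in Hw.
    destruct Hw as (Hv & _ & l & r & q & sg & HR & Hq & -> & _ & Hr & Hsg).
    destruct q as [| i q].
    + exists [], l, r, sg; repeat (split; [assumption |]).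
      intros q w Hq' Hw Hred; apply Hno; exists q, w; auto.
    + exfalso; apply Hno; exists (i :: q), (subst sg l); split; [discriminate |].
      split; [assumption |]; exists (subst sg r).
      apply (@rstep_at _ ar R _ [] sg l r); auto.
      exact (wf_subterm_at ar _ _ Hv Hq).
Qed.

Lemma not_prime_inner R u p : ~ prime_at R u p ->
  exists q l r sg, R l r /\ wf ar r /\ (forall x, wf ar (sg x)) /\
    subterm_at u (p ++ q) = Some (subst sg l) /\ prime_at R u (p ++ q).
Proof.
  intros Hnp; apply NNPP; intros Hno; apply Hnp; intros q v _ Hv Hred; apply Hno.
  destruct (innermost_redex Hred) as (q' & l & r & sg & HR & Hr & Hsg & Hl & Hprime).
  exists (q ++ q'), l, r, sg; rewrite app_assoc, (subterm_at_app _ _ _ Hv).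
  split; [assumption | split; [assumption | split; [assumption | split; [assumption |]]]].
  intros q'' w Hq''; rewrite <- app_assoc, (subterm_at_app _ _ _ Hv).
  exact (Hprime q'' w Hq'').
Qed.

End CriticalPairs.

(** * Local peaks and cliffs *)

Section Local.
Variable F : Type.
Variable ar : F -> nat.
Variable B : pairs F.
Variable gt : term F -> term F -> Prop.
Hypothesis Hgt : B_compatible_reduction_order ar B gt.
Hypothesis HBwf : ES ar B.
Hypothesis HBvars : forall l r, B l r -> forall x, In x (vars l) <-> In x (vars r).
Variable R : pairs F.
Hypothesis HR : ordered ar gt R.
Hypothesis Hll : left_linear R.

Notation gtw := (gtw ar gt).
Notation simB := (simB ar B).
Notation X := (punion R B).

Definition below (u s t : term F) : Prop := conv_in ar X (gtw u) s t.

(** In a cliff [t] is equivalent to [u], hence not below it, so a first step out of [t] is kept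
    apart from the conversion below [u]. *)
Definition cliff_below (u s t : term F) : Prop :=
  exists v, rstep ar R t v /\ below u v s.

(** This and the next hypothesis are what fairness provides for instances of prime critical
    pairs. *)
Hypothesis HPP : forall a b d u,
  PCP ar R a b -> (forall x, wf ar (d x)) ->
  gtw u (subst d a) -> gtw u (subst d b) -> below u (subst d a) (subst d b).

(** The side [b] always stems from the [B]-step; as the rule may be the inner or the outer partner,
    the critical pair can appear in either order. *)
Hypothesis HPC : forall a b d u,
  PCP_pm ar R (sym_pairs B) a b \/ PCP_pm ar R (sym_pairs B) b a ->
  (forall x, wf ar (d x)) ->
  gtw u (subst d a) -> simB u (subst d b) -> cliff_below u (subst d a) (subst d b).

Lemma rule_wf l r : R l r -> wf ar l /\ wf ar r.
Proof. intros H; destruct (HR H) as (? & ? & _); auto. Qed.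

Lemma rule_vars l r : R l r -> forall x, In x (vars r) -> In x (vars l).
Proof. intros H; exact (gtw_vars Hgt (HR H)). Qed.

Lemma sym_B_wf l r : sym_pairs B l r -> wf ar l /\ wf ar r.
Proof. intros [H | H]; apply HBwf in H; tauto. Qed.

Lemma sym_B_vars l r : sym_pairs B l r -> forall x, In x (vars l) <-> In x (vars r).
Proof. intros [H | H] x; apply HBvars with (x := x) in H; tauto. Qed.

Lemma sym_B_step l r sg : sym_pairs B l r -> (forall x, wf ar (sg x)) ->
  sym_step ar B (subst sg l) (subst sg r).
Proof.
  intros H Hsg; assert (Hwf := sym_B_wf H).
  destruct H as [H | H]; [left | right]; apply rstep_root; tauto.
Qed.

Lemma below_trans u s t v : below u s t -> below u t v -> below u s v.
Proof. apply conv_in_trans. Qed.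

Lemma below_sym u s t : below u s t -> below u t s.
Proof. apply conv_in_sym. Qed.

Lemma below_ctx C p u s t : wf ar C -> subterm_at C p = Some u -> below u s t ->
  below C (replace_at C p s) (replace_at C p t).
Proof.
  intros HC Hp; apply (@conv_in_ctx _ ar X (gtw u) (gtw C) C p u); auto.
  intros a Ha; rewrite <- (replace_at_self _ _ Hp) at 1; eapply gtw_ctx; eauto.
Qed.

Lemma below_rewrites u s t : gtw u s -> clos_refl_trans _ (rstep ar R) s t -> below u s t.
Proof.
  intros Hu Hst; apply (@conv_in_rewrites _ ar B gt Hgt R X); auto.
  - intros a b H; left; assumption.
  - exact (@down_closed_gtw _ ar B gt Hgt u).
Qed.

Lemma below_sim u s t : gtw u s -> simB s t -> below u s t.
Proof.
  intros Hu Hst; apply (@conv_in_sim _ ar B gt X); auto.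
  - intros a b H; right; assumption.
  - exact (@down_closed_gtw _ ar B gt Hgt u).
Qed.

Lemma gtw_rewrites u s t : gtw u s -> clos_refl_trans _ (rstep ar R) s t -> gtw u t.
Proof.
  intros Hu Hst; apply (gtw_geq_trans Hgt Hu), (rewrites_geq Hgt HR Hst).
Qed.

Lemma cliff_below_ctx C p u s t :
  wf ar C -> subterm_at C p = Some u -> cliff_below u s t ->
  cliff_below C (replace_at C p s) (replace_at C p t).
Proof.
  intros HC Hp (v & Hv & Hvs); exists (replace_at C p v); split.
  - eapply rstep_ctx; eauto.
  - exact (below_ctx _ _ HC Hp Hvs).
Qed.

Lemma fupd_wf s x v : (forall y, wf ar (s y)) -> wf ar v ->
  forall y : nat, wf ar (fupd s x v y).
Proof. intros Hs Hv y; unfold fupd; destruct (PeanoNat.Nat.eqb y x); auto. Qed.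

Lemma rewrites_fupd s x v t : wf ar t -> (forall y, wf ar (s y)) -> rstep ar R (s x) v ->
  clos_refl_trans _ (rstep ar R) (subst s t) (subst (fupd s x v) t).
Proof.
  intros Ht Hs Hv; apply ctx_closed_subst with (ar := ar); auto.
  - intros; eapply rstep_ctx; eauto.
  - apply fupd_wf; [assumption | apply (rstep_wf Hv)].
  - intros y _; destruct (PeanoNat.Nat.eq_dec y x) as [-> | Hy].
    + rewrite fupd_same; apply rt_step; assumption.
    + rewrite fupd_other by assumption; apply rt_refl.
Qed.

Lemma conv_fupd s x v t : wf ar t -> (forall y, wf ar (s y)) -> sym_step ar B (s x) v ->
  simB (subst s t) (subst (fupd s x v) t).
Proof.
  intros Ht Hs Hv; apply ctx_closed_subst with (ar := ar); auto.
  - intros; eapply sym_step_ctx; eauto.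
  - apply fupd_wf; [assumption | apply (sym_step_wf Hv)].
  - intros y _; destruct (PeanoNat.Nat.eq_dec y x) as [-> | Hy].
    + rewrite fupd_same; apply rt_step; assumption.
    + rewrite fupd_other by assumption; apply rt_refl.
Qed.

Lemma rewrites_replace_fupd s x v t p :
  wf ar t -> (forall y, wf ar (s y)) -> rstep ar R (s x) v ->
  subterm_at t p = Some (Var x) ->
  clos_refl_trans _ (rstep ar R) (replace_at (subst s t) p v) (subst (fupd s x v) t).
Proof.
  intros Ht Hs Hv Hp; apply ctx_closed_fupd with (ar := ar); auto.
  - intros; eapply rstep_ctx; eauto.
  - apply (rstep_wf Hv).
Qed.

(** * Overlaps whose outer step is at the root *)

Section RootOverlap.
Variables (l1 r1 l2 r2 : term F) (s1 s2 : nat -> term F) (p : list nat).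
Hypothesis Hs1 : forall x, wf ar (s1 x).
Hypothesis Hs2 : forall x, wf ar (s2 x).
Hypothesis Hp : subterm_at (subst s2 l2) p = Some (subst s1 l1).

Notation u := (subst s2 l2).
Notation inner := (replace_at (subst s2 l2) p (subst s1 r1)).
Notation outer := (subst s2 r2).

Lemma inner_rstep (Y : pairs F) : Y l1 r1 -> wf ar l2 -> wf ar r1 -> rstep ar Y u inner.
Proof.
  intros HY H2 H1; apply (@rstep_at _ ar Y u p s1 l1 r1); auto.
  apply wf_subst; auto.
Qed.

Lemma var_overlap p1 p2 x :
  p = p1 ++ p2 -> subterm_at l2 p1 = Some (Var x) ->
  subterm_at (s2 x) p2 = Some (subst s1 l1) ->
  inner = replace_at u p1 (replace_at (s2 x) p2 (subst s1 r1)).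
Proof.
  intros -> H1 H2; apply replace_at_app.
  exact (subterm_at_subst s2 _ _ H1).
Qed.

Lemma root_peak_prime : R l1 r1 -> R l2 r2 -> prime_at ar R u p -> below u inner outer.
Proof.
  intros H1 H2 Hprime.
  destruct (rule_wf H1) as [Hl1 Hr1]; destruct (rule_wf H2) as [Hl2 Hr2].
  assert (Hui : gtw u inner) by (apply (rstep_gtw Hgt HR), inner_rstep; assumption).
  assert (Huo : gtw u outer) by (apply (rstep_gtw Hgt HR), rstep_root; assumption).
  destruct (subterm_at_subst_inv _ _ _ Hp) as [(f & ts & Hf) | (p1 & p2 & x & Hpp & Hx & Hq)].
  - destruct (@critical_instance F ar R R R l1 r1 l2 r2 s1 s2 p f ts)
      as [-> | (a & b & d & Hab & Hd & Ha & Hb)]; auto.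
    + apply rule_vars; assumption.
    + assert (Hp' := subterm_at_subst s2 _ _ Hf); congruence.
    + apply conv_in_refl.
    + rewrite <- Ha, <- Hb; apply HPP; [exact Hab | exact Hd | rewrite Ha | rewrite Hb]; assumption.
  - assert (Hv := @rstep_at _ ar R (s2 x) p2 s1 l1 r1 H1 (Hs2 x) Hr1 Hs1 Hq).
    rewrite (var_overlap _ _ Hpp Hx Hq) in *.
    (* Variable overlap: the remaining copies of [x] in [l2] and all copies in [r2] are rewritten
       alike, and the outer rule connects the results. *)
    apply below_trans with (subst (fupd s2 x (replace_at (s2 x) p2 (subst s1 r1))) l2).
    + apply below_rewrites, rewrites_replace_fupd; assumption.
    + apply below_trans with (subst (fupd s2 x (replace_at (s2 x) p2 (subst s1 r1))) r2).
      * apply conv_in_step.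
        -- left; apply rstep_mono with R; [left; assumption |].
           apply rstep_root; auto; apply fupd_wf; [assumption | apply (rstep_wf Hv)].
        -- apply (gtw_rewrites Hui), rewrites_replace_fupd; assumption.
        -- apply (gtw_rewrites Huo), rewrites_fupd; assumption.
      * apply below_sym, below_rewrites; [| apply rewrites_fupd]; assumption.
Qed.

Lemma root_cliff_RB_prime :
  R l1 r1 -> sym_pairs B l2 r2 -> prime_at ar R u p -> cliff_below u inner outer.
Proof.
  intros H1 H2 Hprime.
  destruct (rule_wf H1) as [Hl1 Hr1]; destruct (sym_B_wf H2) as [Hl2 Hr2].
  assert (Hui : gtw u inner) by (apply (rstep_gtw Hgt HR), inner_rstep; assumption).
  assert (Huo : simB u outer) by (apply rt_step, sym_B_step; assumption).
  destruct (subterm_at_subst_inv _ _ _ Hp) as [(f & ts & Hf) | (p1 & p2 & x & Hpp & Hx & Hq)].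
  - destruct (@critical_instance F ar R R (sym_pairs B) l1 r1 l2 r2 s1 s2 p f ts)
      as [Heq | (a & b & d & Hab & Hd & Ha & Hb)]; auto.
    + apply rule_vars; assumption.
    + assert (Hp' := subterm_at_subst s2 _ _ Hf); congruence.
    (* Equal results are impossible: one is below [u], the other equivalent to [u]. *)
    + rewrite Heq in Hui; destruct (gtw_not_sim Hgt Hui Huo).
    + rewrite <- Ha, <- Hb; apply HPC; [left; left; exact Hab | exact Hd | rewrite Ha | rewrite Hb]; assumption.
  - assert (Hv := @rstep_at _ ar R (s2 x) p2 s1 l1 r1 H1 (Hs2 x) Hr1 Hs1 Hq).
    rewrite (var_overlap _ _ Hpp Hx Hq) in *.
    set (v := replace_at (s2 x) p2 (subst s1 r1)) in *.
    (* Equations of [B] have the same variables on both sides, so [r2] contains a copy of [x] whose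
       instance can be rewritten; this is the step leaving [outer]. *)
    destruct (in_vars_subterm_at r2 x) as (p' & Hp').
    { apply (sym_B_vars H2), (subterm_at_var_in p1 _ Hx). }
    assert (Hp'' := subterm_at_subst s2 _ _ Hp').
    assert (Hstep : rstep ar R outer (replace_at outer p' v)).
    { rewrite <- (replace_at_self _ _ Hp'') at 1.
      eapply rstep_ctx; eauto; apply wf_subst; auto. }
    assert (Huv : gtw u (replace_at outer p' v)).
    { apply (geq_gtw_trans Hgt) with outer; [right; assumption |].
      exact (rstep_gtw Hgt HR Hstep). }
    exists (replace_at outer p' v); split; [assumption |].
    apply below_trans with (subst (fupd s2 x v) r2).
    + apply below_rewrites, rewrites_replace_fupd; assumption.
    + apply below_trans with (subst (fupd s2 x v) l2).
      * apply conv_in_step.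
        -- apply sym_step_sym, sym_step_mono with B; [right; assumption |].
           apply sym_B_step; auto; apply fupd_wf; [assumption | apply (rstep_wf Hv)].
        -- apply (gtw_rewrites Huv), rewrites_replace_fupd; assumption.
        -- apply (gtw_rewrites Hui), rewrites_replace_fupd; assumption.
      * apply below_sym, below_rewrites; [| apply rewrites_replace_fupd]; assumption.
Qed.

Lemma root_cliff_BR_prime :
  sym_pairs B l1 r1 -> R l2 r2 -> prime_at ar R u p -> cliff_below u outer inner.
Proof.
  intros H1 H2 Hprime.
  destruct (sym_B_wf H1) as [Hl1 Hr1]; destruct (rule_wf H2) as [Hl2 Hr2].
  assert (Huo : gtw u outer) by (apply (rstep_gtw Hgt HR), rstep_root; assumption).
  assert (Hui : simB u inner).
  { rewrite <- (replace_at_self _ _ Hp) at 1.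
    eapply conv_ctx; [apply wf_subst; auto | eassumption |].
    apply rt_step, sym_B_step; assumption. }
  destruct (subterm_at_subst_inv _ _ _ Hp) as [(f & ts & Hf) | (p1 & p2 & x & Hpp & Hx & Hq)].
  - destruct (@critical_instance F ar R (sym_pairs B) R l1 r1 l2 r2 s1 s2 p f ts)
      as [Heq | (a & b & d & Hab & Hd & Ha & Hb)]; auto.
    + intros x; apply (sym_B_vars H1).
    + assert (Hp' := subterm_at_subst s2 _ _ Hf); congruence.
    + rewrite Heq in Hui; destruct (gtw_not_sim Hgt Huo Hui).
    + rewrite <- Ha, <- Hb; apply HPC; [right; right; exact Hab | exact Hd | rewrite Hb | rewrite Ha]; assumption.
  - assert (Hv : sym_step ar B (s2 x) (replace_at (s2 x) p2 (subst s1 r1))).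
    { rewrite <- (replace_at_self _ _ Hq) at 1.
      eapply sym_step_ctx; [auto | eassumption |]; apply sym_B_step; assumption. }
    rewrite (var_overlap _ _ Hpp Hx Hq) in *.
    (* By left-linearity the result of the [B]-step is again an instance of [l2], so the rule
       applies to it at once; the two instances of [r2] differ only by [B]-steps. *)
    rewrite <- (subst_fupd_linear s2 _ _ (Hll H2) Hx) in *.
    set (v := replace_at (s2 x) p2 (subst s1 r1)) in *.
    exists (subst (fupd s2 x v) r2); split.
    + apply rstep_root; auto; apply fupd_wf; [assumption | apply (sym_step_wf Hv)].
    + apply below_sym, below_sim, conv_fupd; assumption.
Qed.

End RootOverlap.

(* If the peak is not prime, an innermost redex strictly below [p] starts a third step
   that forms a prime peak with each of the two given ones. *)
Lemma root_peak l1 r1 l2 r2 s1 s2 p :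
  R l1 r1 -> R l2 r2 -> (forall x, wf ar (s1 x)) -> (forall x, wf ar (s2 x)) ->
  subterm_at (subst s2 l2) p = Some (subst s1 l1) ->
  below (subst s2 l2) (replace_at (subst s2 l2) p (subst s1 r1)) (subst s2 r2).
Proof.
  intros H1 H2 Hs1 Hs2 Hp.
  destruct (classic (prime_at ar R (subst s2 l2) p)) as [Hprime | Hnp];
    [apply (@root_peak_prime l1 r1 l2 r2 s1 s2 p); assumption |].
  destruct (not_prime_inner Hnp) as (q & l3 & r3 & s3 & H3 & Hr3 & Hs3 & Hq & Hprime).
  assert (Hwf : wf ar (subst s2 l2)) by (apply wf_subst; auto; apply (rule_wf H2)).
  apply below_trans with (replace_at (subst s2 l2) (p ++ q) (subst s3 r3)).
  - apply below_sym.
    rewrite (replace_at_app _ _ _ _ Hp); apply (below_ctx _ _ Hwf Hp).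
    assert (Hq' := Hq); rewrite (subterm_at_app _ _ _ Hp) in Hq'.
    apply (@root_peak_prime l3 r3 l1 r1 s3 s1 q); auto.
    intros q' v Hne Hv; apply (Hprime q' v Hne).
    rewrite <- app_assoc, (subterm_at_app _ _ _ Hp); assumption.
  - apply (@root_peak_prime l3 r3 l2 r2 s3 s2 (p ++ q)); assumption.
Qed.

(** If the overlap is not prime, an innermost redex below [p] forms a prime cliff with the [B]-step
    and a peak with the given rule step. *)
Lemma root_cliff_RB l1 r1 l2 r2 s1 s2 p :
  R l1 r1 -> sym_pairs B l2 r2 -> (forall x, wf ar (s1 x)) -> (forall x, wf ar (s2 x)) ->
  subterm_at (subst s2 l2) p = Some (subst s1 l1) ->
  cliff_below (subst s2 l2) (replace_at (subst s2 l2) p (subst s1 r1)) (subst s2 r2).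
Proof.
  intros H1 H2 Hs1 Hs2 Hp.
  destruct (classic (prime_at ar R (subst s2 l2) p)) as [Hprime | Hnp];
    [apply (@root_cliff_RB_prime l1 r1 l2 r2 s1 s2 p); assumption |].
  destruct (not_prime_inner Hnp) as (q & l3 & r3 & s3 & H3 & Hr3 & Hs3 & Hq & Hprime).
  assert (Hwf : wf ar (subst s2 l2)) by (apply wf_subst; auto; apply (sym_B_wf H2)).
  destruct (@root_cliff_RB_prime l3 r3 l2 r2 s3 s2 (p ++ q)) as (v & Hv & Hvb); auto.
  exists v; split; [assumption |].
  apply below_trans with (replace_at (subst s2 l2) (p ++ q) (subst s3 r3)); [assumption |].
  rewrite (replace_at_app _ _ _ _ Hp); apply (below_ctx _ _ Hwf Hp).
  apply root_peak with l3; auto; rewrite (subterm_at_app _ _ _ Hp) in Hq; assumption.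
Qed.

(** In the non-prime case the innermost redex lies below the [B]-step, forming with it a cliff of
    the kind of [root_cliff_RB] in a context, and a peak with the rule at the root. *)
Lemma root_cliff_BR l1 r1 l2 r2 s1 s2 p :
  sym_pairs B l1 r1 -> R l2 r2 -> (forall x, wf ar (s1 x)) -> (forall x, wf ar (s2 x)) ->
  subterm_at (subst s2 l2) p = Some (subst s1 l1) ->
  cliff_below (subst s2 l2) (subst s2 r2) (replace_at (subst s2 l2) p (subst s1 r1)).
Proof.
  intros H1 H2 Hs1 Hs2 Hp.
  destruct (classic (prime_at ar R (subst s2 l2) p)) as [Hprime | Hnp];
    [apply (@root_cliff_BR_prime l1 r1 l2 r2 s1 s2 p); assumption |].
  destruct (not_prime_inner Hnp) as (q & l3 & r3 & s3 & H3 & Hr3 & Hs3 & Hq & Hprime).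
  assert (Hwf : wf ar (subst s2 l2)) by (apply wf_subst; auto; apply (rule_wf H2)).
  assert (Hq' := Hq); rewrite (subterm_at_app _ _ _ Hp) in Hq'.
  assert (Hcliff : cliff_below (subst s2 l2)
            (replace_at (subst s2 l2) (p ++ q) (subst s3 r3))
            (replace_at (subst s2 l2) p (subst s1 r1))).
  { rewrite (replace_at_app _ _ _ _ Hp); apply (cliff_below_ctx _ _ Hwf Hp).
    apply root_cliff_RB with l3; auto. }
  destruct Hcliff as (v & Hv & Hvb); exists v; split; [assumption |].
  apply below_trans with (replace_at (subst s2 l2) (p ++ q) (subst s3 r3)); [assumption |].
  apply root_peak with l3; auto.
Qed.

(** The common prefix of the two positions is stripped as a context until one position is the root
    or the positions diverge. *)
Lemma peak_at p1 : forall p2 u l1 r1 l2 r2 s1 s2,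
  wf ar u -> R l1 r1 -> R l2 r2 -> (forall x, wf ar (s1 x)) -> (forall x, wf ar (s2 x)) ->
  subterm_at u p1 = Some (subst s1 l1) -> subterm_at u p2 = Some (subst s2 l2) ->
  below u (replace_at u p1 (subst s1 r1)) (replace_at u p2 (subst s2 r2)).
Proof.
  induction p1 as [| i p1 IH]; intros p2 u l1 r1 l2 r2 s1 s2 Hu H1 H2 Hs1 Hs2 Hp1 Hp2.
  { injection Hp1 as ->; apply below_sym; simpl; apply root_peak with l2; assumption. }
  destruct p2 as [| j p2].
  { injection Hp2 as ->; simpl replace_at at 2; apply root_peak with l1; assumption. }
  destruct (PeanoNat.Nat.eq_dec i j) as [<- | Hij].
  - destruct (subterm_at_cons_inv _ _ _ Hp1) as (f & ts1 & a & ts2 & -> & -> & Ha1).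
    assert (Ha : subterm_at (Fun f (ts1 ++ a :: ts2)) [length ts1] = Some a)
      by (rewrite subterm_at_cons; reflexivity).
    assert (Ha2 := Hp2); rewrite subterm_at_cons in Ha2.
    assert (Hrep : forall q v, replace_at (Fun f (ts1 ++ a :: ts2)) (length ts1 :: q) v =
              replace_at (Fun f (ts1 ++ a :: ts2)) [length ts1] (replace_at a q v))
      by (intros q v; exact (replace_at_app [_] q v _ Ha)).
    rewrite (Hrep p1), (Hrep p2); apply (below_ctx _ _ Hu Ha).
    apply IH with (l1 := l1) (l2 := l2); auto.
    exact (wf_subterm_at ar _ _ Hu Ha).
  - assert (Hw1 : rstep ar R u (replace_at u (i :: p1) (subst s1 r1)))
      by (apply rstep_at with l1; auto; apply (rule_wf H1)).
    assert (Hw2 : rstep ar R u (replace_at u (j :: p2) (subst s2 r2)))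
      by (apply rstep_at with l2; auto; apply (rule_wf H2)).
    (* Parallel steps commute: both results rewrite to the term with both redexes contracted. *)
    apply below_trans with
      (replace_at (replace_at u (i :: p1) (subst s1 r1)) (j :: p2) (subst s2 r2)).
    + apply below_rewrites; [exact (rstep_gtw Hgt HR Hw1) |].
      apply rt_step, rstep_at with l2; auto.
      * apply (rstep_wf Hw1).
      * apply (rule_wf H2).
      * eapply subterm_at_parallel; eauto.
    + rewrite (replace_at_parallel _ _ _ _ _ Hij Hp1 Hp2).
      apply below_sym, below_rewrites; [exact (rstep_gtw Hgt HR Hw2) |].
      apply rt_step, rstep_at with l1; auto.
      * apply (rstep_wf Hw2).
      * apply (rule_wf H1).
      * eapply subterm_at_parallel; eauto.
Qed.

Lemma cliff_at p1 : forall p2 u l1 r1 l2 r2 s1 s2,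
  wf ar u -> R l1 r1 -> sym_pairs B l2 r2 ->
  (forall x, wf ar (s1 x)) -> (forall x, wf ar (s2 x)) ->
  subterm_at u p1 = Some (subst s1 l1) -> subterm_at u p2 = Some (subst s2 l2) ->
  cliff_below u (replace_at u p1 (subst s1 r1)) (replace_at u p2 (subst s2 r2)).
Proof.
  induction p1 as [| i p1 IH]; intros p2 u l1 r1 l2 r2 s1 s2 Hu H1 H2 Hs1 Hs2 Hp1 Hp2.
  { injection Hp1 as ->; simpl; apply root_cliff_BR with l2; assumption. }
  destruct p2 as [| j p2].
  { injection Hp2 as ->; simpl replace_at at 2; apply root_cliff_RB with l1; assumption. }
  destruct (PeanoNat.Nat.eq_dec i j) as [<- | Hij].
  - destruct (subterm_at_cons_inv _ _ _ Hp1) as (f & ts1 & a & ts2 & -> & -> & Ha1).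
    assert (Ha : subterm_at (Fun f (ts1 ++ a :: ts2)) [length ts1] = Some a)
      by (rewrite subterm_at_cons; reflexivity).
    assert (Ha2 := Hp2); rewrite subterm_at_cons in Ha2.
    assert (Hrep : forall q v, replace_at (Fun f (ts1 ++ a :: ts2)) (length ts1 :: q) v =
              replace_at (Fun f (ts1 ++ a :: ts2)) [length ts1] (replace_at a q v))
      by (intros q v; exact (replace_at_app [_] q v _ Ha)).
    rewrite (Hrep p1), (Hrep p2); apply (cliff_below_ctx _ _ Hu Ha).
    apply IH with (l1 := l1) (l2 := l2); auto.
    exact (wf_subterm_at ar _ _ Hu Ha).
  - assert (Hw1 : rstep ar R u (replace_at u (i :: p1) (subst s1 r1)))
      by (apply rstep_at with l1; auto; apply (rule_wf H1)).
    assert (Hr2 : wf ar (subst s2 r2)) by (apply wf_subst; auto; apply (sym_B_wf H2)).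
    assert (Hp1' := subterm_at_parallel u (subst s2 r2) _ _ (not_eq_sym Hij) Hp2 Hp1).
    assert (Hp2' := subterm_at_parallel u (subst s1 r1) _ _ Hij Hp1 Hp2).
    (* Contracting the rule's redex after the [B]-step gives a term one [B]-step away from the plain
       rule reduct. *)
    exists (replace_at (replace_at u (j :: p2) (subst s2 r2)) (i :: p1) (subst s1 r1)).
    split.
    + apply rstep_at with l1; auto; [| apply (rule_wf H1)].
      eapply wf_replace_at; eauto.
    + rewrite <- (replace_at_parallel _ _ _ _ _ Hij Hp1 Hp2).
      apply below_sym, below_sim; [exact (rstep_gtw Hgt HR Hw1) |].
      rewrite <- (replace_at_self _ _ Hp2') at 1.
      eapply conv_ctx; [apply (rstep_wf Hw1) | eassumption |].
      apply rt_step, sym_B_step; assumption.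
Qed.

Lemma local_peak u s t : rstep ar R u s -> rstep ar R u t -> below u s t.
Proof.
  intros Hs Ht; apply rstep_elim in Hs; apply rstep_elim in Ht.
  destruct Hs as (Hu & _ & l1 & r1 & p1 & s1 & H1 & Hp1 & -> & _ & _ & Hs1).
  destruct Ht as (_ & _ & l2 & r2 & p2 & s2 & H2 & Hp2 & -> & _ & _ & Hs2).
  apply peak_at with l1 l2; assumption.
Qed.

Lemma local_cliff u s t : rstep ar R u s -> sym_step ar B u t -> cliff_below u s t.
Proof.
  intros Hs Ht; apply rstep_elim in Hs.
  destruct Hs as (Hu & _ & l1 & r1 & p1 & s1 & H1 & Hp1 & -> & _ & _ & Hs1).
  assert (Ht' : exists l2 r2 p2 s2, sym_pairs B l2 r2 /\ (forall x, wf ar (s2 x)) /\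
            subterm_at u p2 = Some (subst s2 l2) /\ t = replace_at u p2 (subst s2 r2)).
  { destruct Ht as [Ht | Ht]; apply rstep_elim in Ht;
      destruct Ht as (_ & _ & l2 & r2 & p2 & s2 & H2 & Hp2 & Heq & _ & _ & Hs2).
    - exists l2, r2, p2, s2; repeat split; auto; left; assumption.
    - exists r2, l2, p2, s2; subst u; split; [right; assumption |].
      split; [assumption | split; [eapply subterm_at_replace; eauto |]].
      rewrite (replace_at_twice _ _ _ _ Hp2); symmetry; apply replace_at_self; assumption. }
  destruct Ht' as (l2 & r2 & p2 & s2 & H2 & Hs2 & Hp2 & ->).
  apply cliff_at with l1 l2; assumption.
Qed.

(** * The Church-Rosser property *)

(* Cliffs transport a rewrite step along [~], so reducibility is invariant under [~]. *)
Lemma cliff_chain u t : simB u t -> forall s, rstep ar R u s -> cliff_below u s t.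
Proof.
  intros H; apply clos_rt_rtn1 in H; induction H as [| t t' Htt' Hut IH]; intros s Hs.
  - exists s; split; [assumption | apply conv_in_refl].
  - apply clos_rtn1_rt in Hut; destruct (IH s Hs) as (v & Hv & Hvs).
    destruct (local_cliff Hv Htt') as (w & Hw & Hwv).
    exists w; split; [assumption |].
    apply below_trans with v; [| assumption].
    revert Hwv; apply conv_in_mono; [auto |].
    intros a Ha; apply (geq_gtw_trans Hgt) with t; [right |]; assumption.
Qed.

Definition mod_normal (v : term F) : Prop := ~ exists w, rstep_mod ar B R v w.

Definition reaches : relation (term F) :=
  clos_refl_trans _ (fun a b => rstep ar R a b \/ sym_step ar B a b).

Definition unique_mod_nf (u : term F) : Prop :=
  forall v w, reaches u v -> reaches u w -> mod_normal v -> mod_normal w -> simB v w.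

Lemma reaches_cases u v : reaches u v ->
  simB u v \/ exists u' s, simB u u' /\ rstep ar R u' s /\ reaches s v.
Proof.
  intros H; apply clos_rt_rt1n in H; induction H as [u | u u1 v [H | H] Hv IH].
  - left; apply rt_refl.
  - right; exists u, u1; split; [apply rt_refl | split; [assumption |]].
    apply clos_rt1n_rt; assumption.
  - assert (Huu : simB u u1) by (apply rt_step; assumption).
    destruct IH as [IH | (u' & s & IH & Hs)].
    + left; exact (conv_trans Huu IH).
    + right; exists u', s; split; [exact (conv_trans Huu IH) | assumption].
Qed.

(** A term without a plain [R]-step is already normal for [R/B]: a step from an equivalent term
    would be carried over by cliffs. *)
Lemma reaches_mod_nf u : exists v, reaches u v /\ clos_refl_trans _ (rstep ar R) u v /\
  mod_normal v.
Proof.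
  induction u as [u IH] using (well_founded_induction (gtw_wf Hgt)).
  destruct (classic (exists s, rstep ar R u s)) as [(s & Hs) | Hno].
  - destruct (IH s (rstep_gtw Hgt HR Hs)) as (v & Hv1 & Hv2 & Hv3).
    exists v; split; [| split; [| assumption]].
    + apply rt_trans with s; [apply rt_step; left |]; assumption.
    + apply rt_trans with s; [apply rt_step |]; assumption.
  - exists u; split; [apply rt_refl | split; [apply rt_refl |]].
    intros (w & u' & s & Hu & Hs & _); apply Hno.
    destruct (cliff_chain (conv_sym Hu) Hs) as (v & Hv & _); exists v; assumption.
Qed.

Lemma unique_mod_nf_step a b v w :
  sym_step ar X a b -> unique_mod_nf a -> unique_mod_nf b ->
  reaches a v -> reaches b w -> mod_normal v -> mod_normal w -> simB v w.
Proof.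
  assert (Hhalf : forall a b v w, rstep ar X a b -> unique_mod_nf a ->
            reaches a v -> reaches b w -> mod_normal v -> mod_normal w -> simB v w).
  { clear; intros a b v w H Ha Hv Hw; apply Ha; [assumption |].
    apply rt_trans with b; [| assumption]; apply rt_step.
    destruct H as (H1 & H2 & l & r & p & sg & [H | H] & Hp);
      [left | right; left]; (split; [assumption | split; [assumption |]]);
      exists l, r, p, sg; auto. }
  intros [H | H] Ha Hb Hv Hw Nv Nw.
  - exact (Hhalf _ _ _ _ H Ha Hv Hw Nv Nw).
  - exact (conv_sym (Hhalf _ _ _ _ H Hb Hw Hv Nw Nv)).
Qed.

(** Each intermediate term gets a normal form; neighbours share theirs up to [simB], since whatever
    one end of a step reaches is reachable from the other. *)
Lemma below_mod_nf u s t : (forall a, gtw u a -> unique_mod_nf a) -> gtw u s ->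
  below u s t ->
  forall v w, reaches s v -> reaches t w -> mod_normal v -> mod_normal w -> simB v w.
Proof.
  intros IH Hs H; apply clos_rt_rtn1 in H.
  induction H as [| t t' (Htt' & Hut & Hut') H IHt]; intros v w Hv Hw Nv Nw.
  - exact (IH s Hs v w Hv Hw Nv Nw).
  - destruct (reaches_mod_nf t) as (x & Hx & _ & Nx).
    apply conv_trans with x; [exact (IHt v x Hv Hx Nv Nx) |].
    exact (unique_mod_nf_step Htt' (IH _ Hut) (IH _ Hut') Hx Hw Nx Nw).
Qed.

Lemma unique_mod_nf_all u : unique_mod_nf u.
Proof.
  induction u as [u IH] using (well_founded_induction (gtw_wf Hgt)).
  (* If the class of [u] contains a normal form, no member of the class is reducible; this excludes
     the mixed cases. *)
  assert (Hnf : forall v u' s, mod_normal v -> simB u v -> simB u u' ->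
            rstep ar R u' s -> False).
  { intros v u' s Hv Huv Huu' Hs; apply Hv; exists s, u', s.
    split; [exact (conv_trans (conv_sym Huv) Huu') | split; [assumption | apply rt_refl]]. }
  intros v w Hv Hw Nv Nw.
  apply reaches_cases in Hv; apply reaches_cases in Hw.
  destruct Hv as [Hv | (u1 & s1 & Hu1 & Hs1 & Hv)];
    destruct Hw as [Hw | (u2 & s2 & Hu2 & Hs2 & Hw)].
  - exact (conv_trans (conv_sym Hv) Hw).
  - destruct (Hnf _ _ _ Nv Hv Hu2 Hs2).
  - destruct (Hnf _ _ _ Nw Hw Hu1 Hs1).
  (* The step out of [u1] is moved along the class to [u2], where it forms an ordinary peak with the
     step to [s2]. *)
  - destruct (cliff_chain (conv_trans (conv_sym Hu1) Hu2) Hs1) as (s & Hs & Hss1).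
    assert (Hbelow : below u s1 s2).
    { assert (Hlift : forall u', simB u u' -> forall a b, below u' a b -> below u a b).
      { intros u' Huu' a b; apply conv_in_mono; [auto |].
        intros c Hc; apply (geq_gtw_trans Hgt) with u'; [right |]; assumption. }
      apply below_trans with s.
      - apply below_sym; exact (Hlift _ Hu1 _ _ Hss1).
      - exact (Hlift _ Hu2 _ _ (local_peak Hs Hs2)). }
    refine (below_mod_nf IH _ Hbelow Hv Hw Nv Nw).
    apply (geq_gtw_trans Hgt) with u1; [right; assumption |].
    exact (rstep_gtw Hgt HR Hs1).
Qed.

Lemma church_rosser : church_rosser_mod ar B R.
Proof.
  intros s t H.
  destruct (reaches_mod_nf s) as (v & Hv & Hv' & Nv).
  destruct (reaches_mod_nf t) as (w & Hw & Hw' & Nw).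
  exists v, w; split; [assumption | split; [| assumption]].
  clear Hv' Hw'; revert w Hw Nw; apply clos_rt_rtn1 in H.
  induction H as [| t t' Htt' H IH]; intros w Hw Nw.
  - exact (@unique_mod_nf_all s v w Hv Hw Nv Nw).
  - destruct (reaches_mod_nf t) as (x & Hx & _ & Nx).
    apply conv_trans with x; [apply IH; assumption |].
    exact (unique_mod_nf_step Htt' (@unique_mod_nf_all t) (@unique_mod_nf_all t') Hx Hw Nx Nw).
Qed.

End Local.

(** * From fairness to the closure of critical pairs, and the theorem *)

Lemma joinable_mod_subst (F : Type) (ar : F -> nat) (B R : pairs F) d a b :
  (forall x, wf ar (d x)) -> joinable_mod ar B R a b ->
  joinable_mod ar B R (subst d a) (subst d b).
Proof.
  intros Hd (u & v & Hu & Huv & Hv); exists (subst d u), (subst d v).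
  split; [apply rewrites_subst; assumption |].
  split; [apply conv_subst; assumption | apply rewrites_subst; assumption].
Qed.

Lemma joinable_mod_sym (F : Type) (ar : F -> nat) (B R : pairs F) a b :
  joinable_mod ar B R a b -> joinable_mod ar B R b a.
Proof.
  intros (u & v & Hu & Huv & Hv); exists v, u; split; [assumption |].
  split; [apply conv_sym |]; assumption.
Qed.

Lemma rewrites_cases (F : Type) (ar : F -> nat) (R : pairs F) s t :
  clos_refl_trans _ (rstep ar R) s t ->
  s = t \/ exists s', rstep ar R s s' /\ clos_refl_trans _ (rstep ar R) s' t.
Proof.
  intros H; apply clos_rt_rt1n in H; destruct H as [| s' t H H']; [auto |].
  right; exists s'; split; [assumption | apply clos_rt1n_rt; assumption].
Qed.

Theorem theorem4p12 (F : Type) (ar : F -> nat)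
    (B : pairs F)
    (HB : ES ar B /\ forall l r, B l r -> forall x, In x (vars l) <-> In x (vars r))
    (gt : term F -> term F -> Prop)
    (Hgt : B_compatible_reduction_order ar B gt)
    (E : pairs F) (HE : ES ar E)
    (Es Rs : nat -> pairs F) (n : nat)
    (Hrun : run ar B gt E Es Rs n)
    (Hfair : fair ar B Es Rs n)
    (Hnf : non_failing Es n) :
  (forall s t, conv ar (punion E B) s t <-> conv ar (punion (Rs n) B) s t) /\
  terminating_mod ar B (Rs n) /\
  church_rosser_mod ar B (Rs n).
Proof.
  destruct HB as [HBwf HBvars]; destruct Hfair as (Hll & Hpcp & Hpcpm).
  destruct (run_invariant Hgt HE Hrun (le_n n)) as [_ HR].
  assert (HX : forall a b, eqns B (Es n) (Rs n) a b -> punion (Rs n) B a b).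
  { intros a b [[H | H] | H]; [destruct (Hnf _ _ H) | left | right]; assumption. }
  assert (HX' : forall a b, punion (Rs n) B a b -> eqns B (Es n) (Rs n) a b)
    by (intros a b [H | H]; [left; right | right]; assumption).
  split; [| split].
  - intros s t; rewrite (run_conv_iff Hgt HBwf HE Hrun (le_n n)).
    split; apply conv_mono; assumption.
  - intros (f & Hf); apply (proj1 (proj2 (proj2 Hgt))); exists f; intros i.
    destruct (rstep_mod_gtw Hgt HR (Hf i)) as (? & _ & ?); auto.
  - apply (@church_rosser F ar B gt Hgt HBwf HBvars (Rs n) HR Hll).
    + intros a b d u Hab Hd Ha Hb.
      destruct (Hpcp a b Hab) as [Hj | (i & Hi & Hstep)].
      * apply (@conv_in_joinable _ ar B gt Hgt (Rs n)); auto.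
        -- apply down_closed_gtw; assumption.
        -- apply joinable_mod_subst; assumption.
      (* The pair used at stage [i] may be gone by the end; its step is replayed as a final
         conversion below [u]. *)
      * apply (@conv_in_mono _ ar (eqns B (Es n) (Rs n)) _ (gtw ar gt u)); auto.
        apply (@run_conv_in F ar B gt Hgt HBwf E Es Rs n HE Hrun (n - i) i);
          [lia | apply down_closed_gtw; assumption |].
        apply conv_in_step; auto.
        apply sym_step_mono with (punion (Es i) (Rs i)); [left; assumption |].
        apply sym_step_subst; assumption.
    + intros a b d u Hab Hd Ha Hb.
      assert (Hba : gtw ar gt (subst d b) (subst d a))
        by (apply (geq_gtw_trans Hgt) with u; [right; apply conv_sym |]; assumption).
      assert (Hlift : forall s, conv_in ar (eqns B (Es n) (Rs n)) (gtw ar gt (subst d b)) s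
                 (subst d a) -> below ar B gt (Rs n) u s (subst d a)).
      { intros s; apply conv_in_mono; [assumption |]; intros c Hc.
        apply (geq_gtw_trans Hgt) with (subst d b); [right |]; assumption. }
      assert (Hor : joinable_mod ar B (Rs n) a b \/
                    exists i, i <= n /\ sym_step ar (Rs i) a b).
      { destruct Hab as [Hab | Hab]; destruct (Hpcpm _ _ Hab) as [Hj | (i & Hi & Hstep)].
        - auto.
        - right; eauto.
        - left; apply joinable_mod_sym; assumption.
        - right; exists i; split; [assumption | apply sym_step_sym; assumption]. }
      destruct Hor as [Hj | (i & Hi & Hstep)].
      * apply (joinable_mod_subst _ Hd) in Hj.
        destruct Hj as (s & t & Hs & Hst & Ht).
        assert (Has := rewrites_geq Hgt HR Hs).
        (* The side of [b] must take a step: otherwise [subst d b] would be equivalent to a reduct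
           of the smaller [subst d a]. *)
        destruct (rewrites_cases Ht) as [<- | (v & Hv & Hvt)].
        { exfalso; apply (@gtw_irrefl F ar B gt Hgt (subst d b)).
          apply (gtw_geq_trans Hgt Hba), (geq_trans Hgt Has); right; assumption. }
        exists v; split; [assumption |].
        apply Hlift.
        assert (Hbv := rstep_gtw Hgt HR Hv).
        apply (@conv_in_joinable _ ar B gt Hgt (Rs n)); auto.
        -- apply down_closed_gtw; assumption.
        -- apply joinable_mod_sym; exists s, t; auto.
      (* A step from [a] to [b] would contradict [Hba], since rules of every stage decrease; so the
         step leads from [b] to [a]. Its rule may have been changed later, and [run_rstep] supplies
         a final step out of [subst d b]. *)
      * apply (sym_step_subst _ Hd) in Hstep; destruct Hstep as [H | H].
        { exfalso; apply (@gtw_irrefl F ar B gt Hgt (subst d b)).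
          apply (gtw_trans Hgt Hba).
          destruct (run_invariant Hgt HE Hrun Hi) as [_ HRi].
          exact (rstep_gtw Hgt HRi H). }
        destruct (@run_rstep F ar B gt Hgt HBwf E Es Rs n HE Hrun (n - i) i
                    (subst d b) (subst d a)) as (v & Hv & Hva); [lia | assumption |].
        exists v; auto.
Qed.
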